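(* Let $P_1,\ldots,P_m$ be standard simplices in $\mathbb{R}^n$, let $P=P_1+\cdots+P_m$ be their Minkowski sum, and let $X$ be a fine mixed subdivision of $P$. Then $X$, labeled by $\ell$, is a minimal cellular resolution.
   Context: $\mathbb{K}$ is a field and all monomials are monic monomials in $\mathbb{K}[x_1,\ldots,x_n]$. $V(\cdot)$ denotes the set of vertices of a polytope, cell or cell complex. A standard simplex is a polytope of the form $\mathrm{conv}\{\mathbf{e}_i\mid i\in S\}$ with $\emptyset\ne S\subseteq\{1,\ldots,n\}$, where $\mathbf{e}_1,\ldots,\mathbf{e}_n$ is the standard basis of $\mathbb{R}^n$. The Minkowski sum is $P_1+\cdots+P_m=\{p_1+\cdots+p_m\mid p_i\in P_i\}$. A fine mixed subdivision of $P=P_1+\cdots+P_m$ is a polytopal subdivision of $P$ into polytopes (cells) of the form $B_1+\cdots+B_m$, where each $B_i$ is a simplex that is a face of $P_i$, and the $B_i$ lie in affinely independent subspaces (i.e. the linear subspaces parallel to the affine hulls of $B_1,\ldots,B_m$ are linearly independent, so that $\dim(B_1+\cdots+B_m)=\sum_i\dim B_i$). Labeling: a lattice point $v=(e_1,\ldots,e_n)\in\mathbb{Z}_{\ge0}^n$ has label $\ell(v)=x_1^{e_1}\cdots x_n^{e_n}$, and each cell $\sigma$ has label $\ell(\sigma)=\mathrm{lcm}\{\ell(v)\mid v\in V(\sigma)\}$. A labeled cell complex $X$ is a cellular resolution (of the ideal $\langle \ell(v)\mid v\in V(X)\rangle$) if for every monomial $m$ the subcomplex $\{\sigma\in X\mid\ell(\sigma)\text{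 divides }m\}$ is either empty or acyclic over $\mathbb{K}$. A cellular resolution is minimal if no cell is properly contained in a cell with the same label. *)

(* Defs.v *)
From HB Require Import structures.
From mathcomp Require Import all_boot all_order all_algebra.
From mathcomp Require Import mathcomp_extra boolp classical_sets functions.
From mathcomp Require Import cardinality fsbigop reals.
From mathcomp Require mpoly.

Set Implicit Arguments.
Unset Strict Implicit.
Unset Printing Implicit Defensive.

Import Order.TTheory GRing.Theory Num.Theory.

Local Open Scope classical_set_scope.
Local Open Scope ring_scope.

Section Polytopes.
Variables (R : realType) (n : nat).
Local Notation V := 'rV[R]_n.
Implicit Types (A F P : set V) (X : set (set V)).

Definition conv A : set V :=
  [set x | exists (k : nat) (p : 'I_k -> V) (a : 'I_k -> R),
     [/\ forall i, A (p i), forall i, 0 <= a i, \sum_i a i = 1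
       & x = \sum_i a i *: p i]].

Definition is_polytope A : Prop :=
  exists (k : nat) (p : 'I_k.+1 -> V), A = conv (range p).

Definition is_simplex A : Prop :=
  exists (k : nat) (p : 'I_k.+1 -> V),
    (forall a : 'I_k.+1 -> R,
       \sum_i a i = 0 -> \sum_i a i *: p i = 0 -> forall i, a i = 0) /\
    A = conv (range p).

(* The basis vector e_i is [delta_mx 0 i]. *)
Definition standard_simplex A : Prop :=
  exists S : {set 'I_n},
    S != finset.set0 /\ A = conv [set delta_mx 0 i | i in [set` S]].

Definition dot (a x : V) : R := \sum_i a 0 i * x 0 i.

(* Faces of a polytope are the sets of maximizers of linear functionals; the
   polytope itself is a face (a = 0), and the empty set is not counted. *)
Definition face F A : Prop :=
  exists a : V, F = [set x | A x /\ forall y, A y -> dot a y <= dot a x].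

Definition vertices A : set V := [set v | face [set v] A].

(* The linear subspace parallel to the affine hull of A. *)
Definition direction A : set V :=
  [set v | exists (k : nat) (a : 'I_k -> R) (x y : 'I_k -> V),
     (forall i, A (x i) /\ A (y i)) /\ v = \sum_i a i *: (x i - y i)].

(* The dimension of [direction A]: the largest k for which it contains the
   rows of a k x n matrix of rank k. *)
Definition dim A : nat :=
  \max_(k < n.+1 | `[< exists M : 'M[R]_(k, n),
                         row_free M /\ forall i, direction A (row i M) >]) k.

Definition polytopal_complex X : Prop :=
  [/\ finite_set X,
      forall s, X s -> is_polytope s,
      forall s F, X s -> face F s -> X F
    & forall s t, X s -> X t -> s `&` t !=set0 ->
        face (s `&` t) s /\ face (s `&` t) t].

Definition polytopal_subdivision X P : Prop :=
  polytopal_complex X /\ \bigcup_(s in X) s = P.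

Definition minkowski_sum (m : nat) (B : 'I_m -> set V) : set V :=
  [set x | exists p : 'I_m -> V, (forall i, B i (p i)) /\ x = \sum_i p i].

Definition affinely_independent_spaces (m : nat) (B : 'I_m -> set V) : Prop :=
  forall v : 'I_m -> V, (forall i, direction (B i) (v i)) ->
    \sum_i v i = 0 -> forall i, v i = 0.

Definition fine_mixed_subdivision (m : nat) (P : 'I_m -> set V) X : Prop :=
  polytopal_subdivision X (minkowski_sum P) /\
  forall s, X s -> exists B : 'I_m -> set V,
    [/\ forall i, is_simplex (B i) /\ face (B i) (P i),
        affinely_independent_spaces B
      & s = minkowski_sum B].

End Polytopes.

Section CellularHomology.
Variables (R : realType) (n : nat) (K : fieldType).
Local Notation V := 'rV[R]_n.
Implicit Types (Y : set (set V)) (eps : set V -> set V -> int)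
  (c : set V -> K).

(* [eps s t] is the incidence number [s : t] of cells s and t.  The last two
   conditions say that the composites C_(i+2) -> C_(i+1) -> C_i and
   C_1 -> C_0 -> K of boundary maps vanish; at most two terms of each sum are
   nonzero, since a face of codimension two (including the empty face of an
   edge) lies on exactly two facets. *)
Definition incidence_function Y eps : Prop :=
  [/\ forall s t, Y s -> Y t -> eps s t \in [:: -1; 0; 1],
      forall s t, Y s -> Y t ->
        (eps s t != 0 <-> face t s /\ dim s = (dim t).+1),
      forall s r, Y s -> Y r -> \sum_(t \in Y) eps s t * eps t r = 0
    & forall s, Y s -> dim s = 1%N -> \sum_(t \in Y) eps s t = 0].

(* Chains are functions on all sets, supported on the i-dimensional cells. *)
Definition chain Y (i : nat) c : Prop :=
  forall s, c s != 0 -> Y s /\ dim s = i.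

Definition boundary Y eps c (t : set V) : K :=
  \sum_(s \in Y) (eps s t)%:~R * c s.

Definition augmentation Y c : K := \sum_(s \in Y) c s.

Definition reduced_cycle Y eps (i : nat) c : Prop :=
  chain Y i c /\
  if i == 0%N then augmentation Y c = 0
  else forall t, Y t -> boundary Y eps c t = 0.

(* The reduced cellular homology of Y over K vanishes: [Y !=set0] is vanishing
   in degree -1, where the augmentation has to be onto.  The incidence function
   of a polytopal complex is unique up to reorienting its cells, so that the
   choice of [eps] is immaterial. *)
Definition acyclic Y : Prop :=
  Y !=set0 /\
  exists eps, incidence_function Y eps /\
    forall i c, reduced_cycle Y eps i c ->
      exists b, chain Y i.+1 b /\ forall t, Y t -> c t = boundary Y eps b t.

End CellularHomology.

Arguments acyclic {R n} K Y.

Section Labels.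
Variables (R : realType) (n : nat).
Local Notation V := 'rV[R]_n.
(* Monic monomials in x_1, ..., x_n. *)
Local Notation monomial := (mpoly.multinom n).

(* The monomial x^v; meaningful for v with natural number coordinates, where
   [Num.truncn] recovers the exponents. *)
Definition point_label (v : V) : monomial :=
  mpoly.Multinom [tuple Num.truncn (v 0 i) | i < n].

Definition cell_label (s : set V) : monomial :=
  \big[@mpoly.mlcm n/@mpoly.mnm0 n]_(v \in vertices s) point_label v.

Definition divides (m1 m2 : monomial) : bool := mpoly.lem m1 m2.

Definition cellular_resolution (K : fieldType) (label : set V -> monomial)
    (X : set (set V)) : Prop :=
  forall m : monomial,
    [set s | X s /\ divides (label s) m] = set0 \/
    acyclic K [set s | X s /\ divides (label s) m].

Definition minimal_cellular_resolution (K : fieldType)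
    (label : set V -> monomial) (X : set (set V)) : Prop :=
  cellular_resolution K label X /\
  ~ exists s t, [/\ X s, X t, s `<` t & label s = label t].

End Labels.

(* Main.v *)
Require Import Defs.
From HB Require Import structures.
From mathcomp Require Import all_boot all_order all_algebra.
From mathcomp Require Import boolp classical_sets functions cardinality fsbigop.
From mathcomp Require Import reals topology normedtype derive.
From mathcomp Require Import ring lra zify.
From mathcomp Require mpoly.

(** Let C be the set of points x with x_j <= b_j for all j, where x^b is the
    given monomial, and let Y be the subcomplex of the cells whose label divides
    x^b, which are the cells contained in C.

    A fine mixed cell is a sum of simplices conv {e_j : j in S_i}, so it is
    encoded by the bipartite graph S of the pairs (i, j) with j in S_i.  Affine
    independence of the summands says that S is a forest ([forest]).  Faces of
    the cell are the subgraphs T in which no i becomes isolated ([face_mcell],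
    [mcell_face]), the dimension is the number of edges minus m ([dim_mcell]),
    and the exponent of x_j in the label is the degree of j ([divides_label]).
    A proper face misses an edge, so some degree drops: this is minimality.
    A cell may have several such encodings, and adjacent cells need not have
    compatible ones; every argument below uses the encoding of one cell and
    those it induces on its faces.

    Compare Y with the cells that meet C.  These cover the convex set of the
    points of P in C, and their nerve is acyclic ([convex_nerve_acyclic]): if two
    cells are disjoint inside C, a hyperplane separates them, each closed half
    of C meets fewer cells, and Mayer-Vietoris applies; if any two cells
    intersect inside C, there is a smallest cell and the nerve is a cone.
    Inside one cell that meets C, the faces lying in C form an acyclic complex
    ([local_exact]): as long as some row of the forest has two edges there is a
    leaf, and the edge of that leaf is either forbidden by the degree bound, or
    can be added to every subgraph of bounded degree, which gives a homotopy
    onto a smaller forest.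
    A double complex then transfers the acyclicity of the nerve to Y
    ([double_complex_exact]): its entries are the pairs of a list of cells and a
    face of Y contained in all of them; the empty face is allowed when the
    cells of the list have a common point in C.  Columns are exact by the local
    statement, rows by the nerve statement or because they are cones.

    All of this is done with cochains, where restriction to fewer cells is just
    restriction of functions; over a field, exactness for cochains and for
    chains are equivalent ([transpose_exact]).

    Choose generic linear functionals f_0, f_1, ... such that the first d of
    them are injective on the directions of each cell of dimension d.  A cell s
    of dimension d contains a unique direction l_s killed by the first d - 1
    functionals and with value 1 under the next one.  The incidence number of a
    facet t of s is the sign on l_s of a functional that is maximal over s
    exactly on t ([inc]).  In the graph encoding this is minus the sign of the
    coefficient of l_s at the missing edge ([support_sign]), which turns the
    identity of the two paths from a cell to a face of codimension two into a
    short computation ([inc_diamond]). *)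

Set Implicit Arguments.
Unset Strict Implicit.
Unset Printing Implicit Defensive.

Import Order.TTheory GRing.Theory Num.Theory.
Import numFieldNormedType.Exports.
Local Open Scope ring_scope.
Local Notation dim := Defs.dim.

(** * Cochains on lists and a double complex argument *)

Section Delta.
Variables (I : eqType) (K : fieldType).
Implicit Types (phi psi : seq I -> K) (t u : seq I).

(** The coboundary of the complex of ordered lists: unfolding the recursion, the
    value at a list is the alternating sum of the values at the lists with one
    entry omitted. *)
Fixpoint delta phi t : K :=
  if t is x :: t' then phi t' - delta (fun u => phi (x :: u)) t' else 0.

Lemma delta_ext phi psi t :
  (forall u, subseq u t -> (size u).+1 = size t -> phi u = psi u) ->
  delta phi t = delta psi t.
Proof.
elim: t phi psi => //= x t IH phi psi h.
rewrite (h t (subseq_cons _ _) erefl).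
rewrite (IH _ (fun u => psi (x :: u))) // => u ut su.
by apply: h; rewrite /= ?eqxx// su.
Qed.

Lemma deltaB phi psi t :
  delta (fun u => phi u - psi u) t = delta phi t - delta psi t.
Proof.
elim: t phi psi => [|x t IH] phi psi /=; first by rewrite subrr.
by rewrite IH; ring.
Qed.

Lemma delta_sum (J : finType) (a : J -> K) (phi : seq I -> J -> K) t :
  delta (fun u => \sum_j a j * phi u j) t =
  \sum_j a j * delta (phi^~ j) t.
Proof.
elim: t phi => [|x t IH] phi /=.
  by rewrite big1 // => j _; rewrite mulr0.
rewrite (IH (fun u j => phi (x :: u) j)) -sumrB.
by apply: eq_bigr => j _; rewrite mulrBr.
Qed.

Lemma delta_delta phi t : delta (delta phi) t = 0.
Proof.
elim: t phi => //= x t IH phi.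
by rewrite deltaB IH subr0 subrr.
Qed.

(** Prepending a fixed entry contracts the complex. *)
Lemma delta_cone x phi t :
  delta (fun u => phi (x :: u)) t = phi t - delta phi (x :: t).
Proof. by rewrite /= subKr. Qed.

End Delta.

Section Chase.
Variables (I : eqType) (J : finType) (K : fieldType).
Variables (e : J -> J -> K) (lev : J -> nat) (adm : seq I -> J -> Prop).

Definition cobd (c : J -> K) (s : J) : K := \sum_t e s t * c t.

Hypothesis e2 : forall s r, \sum_t e s t * e t r = 0.
Hypothesis elev : forall s t, e s t != 0 -> lev s = (lev t).+1.
Hypothesis adm_sub : forall u t y, subseq u t -> adm t y -> adm u y.
Hypothesis adm_e : forall t y z, adm t y -> e y z != 0 -> adm t z.

(** The values on a list of the coboundary involve only faces that are
    admissible for that list, and only one level below. *)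
Lemma cobd_ext t s c c' : adm t s ->
  (forall y, adm t y -> lev s = (lev y).+1 -> c y = c' y) ->
  cobd c s = cobd c' s.
Proof.
move=> ts h; apply: eq_bigr => y _.
have [->|nz] := eqVneq (e s y) 0; first by rewrite !mul0r.
by rewrite h //; [exact: adm_e nz | exact: elev].
Qed.

Lemma cobd2 c s : cobd (cobd c) s = 0.
Proof.
rewrite /cobd; under eq_bigr do rewrite mulr_sumr.
rewrite exchange_big big1 //= => r _.
by under eq_bigr do rewrite mulrA; rewrite -mulr_suml e2 mul0r.
Qed.

Lemma cobdB c c' s : cobd (fun y => c y - c' y) s = cobd c s - cobd c' s.
Proof. by rewrite -sumrB; apply: eq_bigr => y _; rewrite mulrBr. Qed.

(** Columns are indexed by lists: cochains on the faces admissible for the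
    list, graded by their level. *)
Definition column_exact (t : seq I) := forall (c : J -> K) l,
  (forall s, adm t s -> lev s = l.+1 -> cobd c s = 0) ->
  exists b, forall s, adm t s -> lev s = l -> c s = cobd b s.

(** Rows are indexed by faces: cochains on the lists for which the face is
    admissible, graded by their length. *)
Definition row_exact (y : J) := forall k (phi : seq I -> K),
  (forall t, adm t y -> size t = k.+1 -> delta phi t = 0) ->
  exists psi, forall t, adm t y -> size t = k -> phi t = delta psi t.

Hypothesis cols : forall t, t != [::] -> column_exact t.
Hypothesis rows : forall y, row_exact y.

(** By induction on the level.  A vertical primitive a of the double cocycle z
    exists because columns of nonempty lists are exact; its horizontal coboundary is again a cocycle in both
    directions one level lower, so it equals the vertical coboundary of a
    horizontal cocycle b', which by exactness of rows is the horizontal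
    coboundary of some b2; subtracting from a the vertical coboundary of b2
    leaves a primitive that is a horizontal cocycle. *)
Lemma double_complex_chase l k (z : seq I -> J -> K) :
  (forall t s, adm t s -> size t = k.+1 -> lev s = l.+1 -> cobd (z t) s = 0) ->
  (forall t s, adm t s -> size t = k.+2 -> lev s = l -> delta (z^~ s) t = 0) ->
  exists b : seq I -> J -> K,
  (forall t s, adm t s -> size t = k.+1 -> lev s = l -> z t s = cobd (b t) s) /\
  (forall t s, adm t s -> size t = k.+2 -> l = (lev s).+1 ->
     delta (b^~ s) t = 0).
Proof.
elim: l k z => [|l IH] k z dz hz.
  exists (fun _ _ => 0); split=> // t s ts st ls.
  have tn : t != [::] by case: (t) st.
  have [b hb] := cols tn (fun y ty => dz t y ty st).
  rewrite hb // /cobd !big1 // => y _; rewrite ?mulr0 //.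
  have [->|/elev] := eqVneq (e s y) 0; first by rewrite mul0r.
  by rewrite ls.
have /choice [a ha] : forall t, exists b, size t = k.+1 ->
    forall s, adm t s -> lev s = l.+1 -> z t s = cobd b s.
  move=> t; have [st|st] := eqVneq (size t) k.+1; last first.
    by exists (fun _ => 0) => /eqP; rewrite (negbTE st).
  have tn : t != [::] by case: (t) st.
  have [b hb] := cols tn (fun y ty => dz t y ty st).
  by exists b.
have dda t s : adm t s -> size t = k.+2 -> lev s = l.+1 ->
    cobd (fun y => delta (a^~ y) t) s = 0.
  move=> ts st ls; rewrite /cobd -delta_sum.
  transitivity (delta (z^~ s) t); last exact: hz.
  apply: delta_ext => u ut su; rewrite ha ?ls //; last exact: adm_sub ts.
  by move: su; rewrite st => -[].
have hda t s : adm t s -> size t = k.+3 -> lev s = l ->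
    delta (fun u => delta (a^~ s) u) t = 0.
  by move=> _ _ _; rewrite delta_delta.
have [b' [b'1 b'2]] := IH k.+1 (fun t s => delta (a^~ s) t) dda hda.
have /choice [b2 hb2] : forall y, exists psi, l = (lev y).+1 ->
    forall t, adm t y -> size t = k.+2 -> b' t y = delta psi t.
  move=> y; have [ly|ly] := eqVneq l (lev y).+1; last first.
    by exists (fun _ => 0) => /eqP; rewrite (negbTE ly).
  have [psi hpsi] := rows (fun t ty st => b'2 t y ty st ly).
  by exists psi.
exists (fun t s => a t s - cobd (fun y => b2 y t) s); split.
  by move=> t s ts st ls; rewrite cobdB cobd2 subr0 ha.
move=> t s ts st [ls]; rewrite deltaB.
rewrite b'1 // {1}/cobd delta_sum; apply/eqP; rewrite subr_eq0; apply/eqP.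
by apply: (cobd_ext ts) => y ty ly; rewrite hb2 // ls.
Qed.

(** The column of the empty list inherits exactness from all other columns and
    all rows.  A cocycle there is constant along the rows, so the chase applies
    to its restriction to lists of length one, and exactness of rows at the
    empty list brings the primitive back. *)
Lemma double_complex_exact : column_exact [::].
Proof.
move=> c l dc.
have dz t s : adm t s -> size t = 1%N -> lev s = l.+1 -> cobd c s = 0.
  by move=> ts _; apply: dc; exact: adm_sub (sub0seq _) ts.
have hz t s : adm t s -> size t = 2 -> lev s = l ->
    delta (fun _ : seq I => c s) t = 0.
  by case: t => [|x[|y[|]]] //= _ _ _; rewrite !subr0 subrr.
have [b [b1 b2]] := double_complex_chase (z := fun _ => c) dz hz.
have /choice [b0 hb0] : forall y, exists psi, l = (lev y).+1 ->
    forall t, adm t y -> size t = 1%N -> b t y = delta psi t.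
  move=> y; have [ly|ly] := eqVneq l (lev y).+1; last first.
    by exists (fun _ => 0) => /eqP; rewrite (negbTE ly).
  have [psi hpsi] := rows (fun t ty st => b2 t y ty st ly).
  by exists psi.
pose g := cobd (fun y => b0 y [::]).
exists (fun y => b0 y [::]) => s sA ls.
have key t : adm t s -> size t = 1%N ->
    delta (fun u : seq I => if u is [::] then c s - g s else 0) t = 0.
  case: t => [|x[|]] //= ts _; rewrite subr0 (b1 _ _ ts) // -/g.
  apply/eqP; rewrite subr_eq0; apply/eqP; apply: (cobd_ext ts) => y ty ly.
  by rewrite (hb0 y _ [:: x]) //= ?subr0 // -ls.
have [psi hpsi] := rows key.
by apply/eqP; rewrite -subr_eq0; apply/eqP; have /= := hpsi [::] sA erefl.
Qed.

End Chase.

(** * From cochains to chains *)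

Lemma sum_enum_val (U : nmodType) (J : finType) (F : J -> U) :
  \sum_j F j = \sum_(i < #|J|) F (enum_val i).
Proof. by rewrite -(big_enum_val (A := J)); apply: eq_bigl. Qed.

(** For a square matrix e with e e = 0, exactness of columns and of rows both say
    that the size of e is twice its rank. *)
Lemma transpose_exact (J : finType) (K : fieldType) (e : J -> J -> K) :
  (forall s r, \sum_t e s t * e t r = 0) ->
  (forall c, (forall s, cobd e c s = 0) -> exists b, forall s, c s = cobd e b s) ->
  forall c, (forall t, \sum_s e s t * c s = 0) ->
    exists b, forall t, c t = \sum_s e s t * b s.
Proof.
move=> e2 ex c hc.
pose M : 'M[K]_#|J| := \matrix_(i, j) e (enum_val i) (enum_val j).
have sumJ := @sum_enum_val K J.
have MM : M *m M = 0.
  by apply/matrixP=> i j; rewrite !mxE -[RHS](e2 (enum_val i) (enum_val j)) sumJ;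
    apply: eq_bigr => k _; rewrite !mxE.
have sub1 : (kermx M^T <= M^T)%MS.
  apply/rV_subP => v /sub_kermxP vM.
  have [|b hb] := ex (fun t => v 0 (enum_rank t)).
    move=> s; have /matrixP/(_ 0 (enum_rank s)) := vM; rewrite !mxE => <-.
    rewrite /cobd sumJ; apply: eq_bigr => k _.
    by rewrite !mxE enum_rankK enum_valK mulrC.
  apply/submxP; exists (\row_i b (enum_val i)); apply/rowP=> i; rewrite !mxE.
  rewrite -[in LHS](enum_valK i) hb /cobd sumJ; apply: eq_bigr => k _.
  by rewrite !mxE mulrC.
have sub2 : (kermx M <= M)%MS.
  have /mxrankS := sub1; rewrite mxrank_ker mxrank_tr => h.
  have MK : (M <= kermx M)%MS by apply/sub_kermxP.
  by rewrite -(geq_leqif (mxrank_leqif_sup MK)) mxrank_ker.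
have : (\row_i c (enum_val i) <= kermx M)%MS.
  apply/sub_kermxP/rowP => j; rewrite !mxE -[RHS](hc (enum_val j)) sumJ.
  by apply: eq_bigr => k _; rewrite !mxE mulrC.
move/submx_trans => /(_ _ _ sub2) /submxP[D /rowP hD].
exists (fun t => D 0 (enum_rank t)) => t.
have := hD (enum_rank t); rewrite !mxE enum_rankK => ->.
by rewrite sumJ; apply: eq_bigr => k _; rewrite !mxE enum_rankK enum_valK mulrC.
Qed.

(** Primitives of the homogeneous components can be glued, as the coboundary at a
    level reads only one level. *)
Lemma ungraded_exact (J : finType) (K : fieldType) (e : J -> J -> K)
    (lev : J -> nat) :
  (forall s t, e s t != 0 -> lev s = (lev t).+1) ->
  (forall (c : J -> K) l, (forall s, lev s = l.+1 -> cobd e c s = 0) ->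
    exists b, forall s, lev s = l -> c s = cobd e b s) ->
  forall c, (forall s, cobd e c s = 0) -> exists b, forall s, c s = cobd e b s.
Proof.
move=> elev ex c hc.
have /choice[b hb] : forall l, exists b, forall s, lev s = l -> c s = cobd e b s.
  by move=> l; apply: ex => s _; exact: hc.
exists (fun t => b (lev t).+1 t) => s; rewrite (hb _ s erefl).
apply: eq_bigr => t _; have [->|/elev ->//] := eqVneq (e s t) 0.
by rewrite !mul0r.
Qed.

(** * Separation of compact convex sets *)

Section Dot.
Local Open Scope classical_set_scope.
Variables (R : realType) (n : nat).
Implicit Types (a x y : 'rV[R]_n).

Lemma dotC a x : dot a x = dot x a.
Proof. by apply: eq_bigr => i _; rewrite mulrC. Qed.

Lemma dotDr a x y : dot a (x + y) = dot a x + dot a y.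
Proof. by rewrite -big_split; apply: eq_bigr => i _; rewrite mxE mulrDr. Qed.

Lemma dotZr a k x : dot a (k *: x) = k * dot a x.
Proof. by rewrite /dot mulr_sumr; apply: eq_bigr => i _; rewrite mxE mulrCA. Qed.

Lemma dotBr a x y : dot a (x - y) = dot a x - dot a y.
Proof. by rewrite dotDr -scaleN1r dotZr mulN1r. Qed.

Lemma dot0r a : dot a 0 = 0.
Proof. by apply: big1 => i _; rewrite mxE mulr0. Qed.

Lemma dotDl a b x : dot (a + b) x = dot a x + dot b x.
Proof. by rewrite !(dotC _ x) dotDr. Qed.

Lemma dotZl a k x : dot (k *: a) x = k * dot a x.
Proof. by rewrite !(dotC _ x) dotZr. Qed.

Lemma dotBl a b x : dot (a - b) x = dot a x - dot b x.
Proof. by rewrite !(dotC _ x) dotBr. Qed.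

Lemma dotNl a x : dot (- a) x = - dot a x.
Proof. by rewrite -scaleN1r dotZl mulN1r. Qed.

Lemma dot_sqrN x : dot (- x) (- x) = dot x x.
Proof. by rewrite dotNl dotC dotNl opprK. Qed.

Lemma dot_line x y k :
  dot (x + k *: y) (x + k *: y) = dot x x + 2 * k * dot x y + k * k * dot y y.
Proof. by rewrite !(dotDl, dotDr, dotZl, dotZr) (dotC y x); ring. Qed.

Lemma dot_sumr (I : Type) (r : seq I) (Q : pred I) a (F : I -> 'rV[R]_n) :
  dot a (\sum_(i <- r | Q i) F i) = \sum_(i <- r | Q i) dot a (F i).
Proof. by apply: (big_morph (dot a)) => [x y|]; rewrite ?dotDr ?dot0r. Qed.

Lemma dot_ge0 x : 0 <= dot x x.
Proof. by apply: sumr_ge0 => i _; rewrite -expr2 sqr_ge0. Qed.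

Lemma dot_gt0 x : x != 0 -> 0 < dot x x.
Proof.
move=> x0; rewrite lt_neqAle dot_ge0 andbT eq_sym.
apply: contra x0 => /eqP h; apply/eqP/rowP => i; rewrite mxE; apply/eqP.
have x2 (j : 'I_n) : true -> 0 <= x 0 j * x 0 j by rewrite -expr2 sqr_ge0.
have xi : x 0 i * x 0 i = 0 by exact: (psumr_eq0P x2 h).
by move/eqP: xi; rewrite mulf_eq0 orbb.
Qed.

Lemma continuous_dot (T : topologicalType) (f g : T -> 'rV[R]_n) :
  continuous f -> continuous g -> continuous (fun p => dot (f p) (g p)).
Proof.
move=> fc gc; apply: continuous_big => [|i _ p]; first exact: add_continuous.
apply: cvgM.
  exact: continuous_comp (fc p) (@coord_continuous _ _ _ 0 i (f p)).
exact: continuous_comp (gc p) (@coord_continuous _ _ _ 0 i (g p)).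
Qed.

End Dot.

Section Separation.
Local Open Scope classical_set_scope.
Variables (R : realType) (n : nat).
Local Notation V := 'rV[R]_n.
Implicit Types (x y w : V) (A B : set V).

Definition is_convex A := forall x y a, A x -> A y -> 0 <= a -> a <= 1 ->
  A (x + a *: (y - x)).

Lemma is_convexI A B : is_convex A -> is_convex B -> is_convex (A `&` B).
Proof.
move=> cA cB x y a [Ax Bx] [Ay By] a0 a1.
by split; [exact: cA | exact: cB].
Qed.

(** At the point x0 of a convex set closest to w, the direction to w makes an
    obtuse angle with every direction into the set: otherwise a short step along
    the segment from x0 to x decreases the distance to w. *)
Lemma closest_obtuse A w x0 : is_convex A -> A x0 ->
  (forall x, A x -> dot (x0 - w) (x0 - w) <= dot (x - w) (x - w)) ->
  forall x, A x -> dot (w - x0) x <= dot (w - x0) x0.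
Proof.
move=> cA Ax0 hmin x Ax; rewrite -subr_le0 -dotBr leNgt; apply/negP.
set p := dot (w - x0) (x - x0) => p0.
set q := dot (x - x0) (x - x0).
have q0 : 0 <= q by exact: dot_ge0.
(* the change of the squared distance to w after a step of length a *)
have key a : 0 <= a -> a <= 1 -> 0 <= a * (a * q - 2 * p).
  move=> a0 a1; have := hmin _ (cA _ _ a Ax0 Ax a0 a1).
  rewrite (_ : x0 + a *: (x - x0) - w = (x0 - w) + a *: (x - x0)); last first.
    by rewrite addrAC.
  rewrite -subr_ge0 dot_line -/q.
  have -> : dot (x0 - w) (x - x0) = - p by rewrite /p !dotBl opprB.
  by congr (_ <= _); ring.
have q1 : 0 < q + p by exact: ltr_wpDl.
(* With q the squared norm of x - x0, any small step contradicts this bound; the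
   chosen one avoids dividing by q, which may be 0. *)
have a0 : 0 < p / (q + p) by rewrite divr_gt0.
have a1 : p / (q + p) <= 1 by rewrite ler_pdivrMr // mul1r lerDr.
have := key _ (ltW a0) a1; rewrite pmulr_rge0 // subr_ge0 mulrAC ler_pdivlMr //.
by nra.
Qed.

(** The hyperplane is the perpendicular bisector of a shortest segment joining
    the two sets, which exists by compactness of their product. *)
Lemma strict_separation A B : compact A -> compact B ->
  is_convex A -> is_convex B -> A !=set0 -> B !=set0 -> A `&` B = set0 ->
  exists (f : V) (t : R), (forall x, A x -> dot f x < t) /\
                          (forall y, B y -> t < dot f y).
Proof.
move=> kA kB cA cB [a0 Aa0] [b0 Bb0] AB0.
pose g (p : V * V) := dot (p.1 - p.2) (p.1 - p.2).
have gc : continuous g.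
  have gc : continuous (fun p : V * V => p.1 - p.2).
    by move=> p; apply: cvgB; [exact: cvg_fst | exact: cvg_snd].
  exact: continuous_dot.
have [||[x0 y0] /set_mem[/= Ax0 By0] hmin] :=
    @compact_EVT_min _ R g (A `*` B) _ (compact_setX kA kB).
- by exists (a0, b0).
- exact: continuous_subspaceT.
have min x y : A x -> B y -> dot (x0 - y0) (x0 - y0) <= dot (x - y) (x - y).
  by move=> Ax By; apply: (hmin (x, y)); apply/mem_set.
have hA := closest_obtuse cA Ax0 (fun x Ax => min x _ Ax By0).
have hB : forall y, B y -> dot (x0 - y0) y <= dot (x0 - y0) y0.
  apply: closest_obtuse => // y By; have := min _ _ Ax0 By.
  by rewrite -[x0 - y0]opprB dot_sqrN -[x0 - y]opprB dot_sqrN.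
have d0 : 0 < dot (y0 - x0) (y0 - x0).
  apply: dot_gt0; rewrite subr_eq0; apply/eqP => xy.
  by have : (A `&` B) x0 by [split; rewrite // -xy]; rewrite AB0.
exists (y0 - x0), ((dot (y0 - x0) x0 + dot (y0 - x0) y0) / 2).
have {}d0 : 0 < dot (y0 - x0) y0 - dot (y0 - x0) x0 by rewrite -dotBr.
split=> [x /hA | y /hB]; first by lra.
by rewrite -[x0 - y0]opprB !dotNl; lra.
Qed.

Lemma halfspace_le_closed (f : V) t : closed [set x | dot f x <= t].
Proof.
have fc : continuous (dot f).
  apply: (@continuous_dot _ _ _ (fun=> f) id) => x; last exact: cvg_id.
  exact: cst_continuous.
apply: (@preimage_closed _ _ (dot f) [set y | y <= t]); last exact: closed_le.
by move=> x _; exact: fc.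
Qed.

Lemma halfspace_le_convex (f : V) t : is_convex [set x | dot f x <= t].
Proof.
move=> x y a /= hx hy a0 a1; rewrite dotDr dotZr dotBr.
by nra.
Qed.

Lemma halfspace_geE (f : V) t : [set x | t <= dot f x] = [set x | dot (- f) x <= - t].
Proof. by apply/seteqP; split => x /=; rewrite dotNl lerN2. Qed.

Lemma halfspace_ge_closed (f : V) t : closed [set x | t <= dot f x].
Proof. by rewrite halfspace_geE; exact: halfspace_le_closed. Qed.

Lemma halfspace_ge_convex (f : V) t : is_convex [set x | t <= dot f x].
Proof. by rewrite halfspace_geE; exact: halfspace_le_convex. Qed.

End Separation.

(** * Convex hulls of finite families *)

Section Hull.
Local Open Scope classical_set_scope.
Variables (R : realType) (n : nat).
Local Notation V := 'rV[R]_n.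

(** The weights of points with the same index are added up, so that a convex
    combination of any length becomes one with a single weight per index. *)
Lemma conv_image (J : finType) (A : set J) (p : J -> V) (x : V) :
  conv (p @` A) x <-> exists b : J -> R,
    [/\ forall j, 0 <= b j, forall j, ~ A j -> b j = 0, \sum_j b j = 1
      & x = \sum_j b j *: p j].
Proof.
split=> [[k [q [a [qA a0 a1 ->]]]] | [b [b0 bA b1 ->]]].
  have /choice[g hg] : forall i, exists j, A j /\ p j = q i.
    by move=> i; have [j Aj pq] := qA i; exists j.
  exists (fun j => \sum_(i | g i == j) a i); split.
  - by move=> j; apply: sumr_ge0 => i _.
  - move=> j Aj; rewrite big1 // => i /eqP gj.
    by have [] := hg i; rewrite gj.
  - rewrite -a1 (partition_big g predT) //=.
  - rewrite (partition_big g predT) //=; apply: eq_bigr => j _.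
    rewrite scaler_suml; apply: eq_bigr => i /eqP gj.
    by have [_ <-] := hg i; rewrite gj.
have [j0 Aj0] : exists j, A j.
  apply: contrapT => /forallNP nA; move: b1; rewrite big1 => [/eqP|j _].
    by rewrite eq_sym oner_eq0.
  exact: bA.
pose h j := if pselect (A j) then j else j0.
exists #|J|, (fun i => p (h (enum_val i))), (fun i => b (enum_val i)).
split=> //.
- by move=> i; exists (h (enum_val i)) => //; rewrite /h; case: pselect.
- by rewrite -(sum_enum_val b).
- rewrite sum_enum_val; apply: eq_bigr => i _; rewrite /h; case: pselect => // nA.
  by rewrite bA // !scale0r.
Qed.

Lemma conv_range (J : finType) (p : J -> V) (x : V) :
  conv (range p) x <-> exists b : J -> R,
    [/\ forall j, 0 <= b j, \sum_j b j = 1 & x = \sum_j b j *: p j].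
Proof.
rewrite conv_image; split=> [[b [b0 _ b1 xE]]|[b [b0 b1 xE]]]; exists b; split => //.
by move=> j [].
Qed.

Lemma conv_image_convex (J : finType) (A : set J) (p : J -> V) :
  is_convex (conv (p @` A)).
Proof.
move=> x y a /conv_image[b [b0 bA b1 ->]] /conv_image[c [c0 cA c1 ->]] a0 a1.
apply/conv_image; exists (fun j => (1 - a) * b j + a * c j); split.
- by move=> j; rewrite addr_ge0 // mulr_ge0 // subr_ge0.
- by move=> j nA; rewrite bA // cA // !mulr0 addr0.
- by rewrite big_split /= -!mulr_sumr b1 c1 !mulr1 subrK.
- rewrite -sumrB scaler_sumr -big_split /=; apply: eq_bigr => j _.
  by apply/rowP => i; rewrite !mxE; ring.
Qed.

Lemma polytope_convex (A : set V) : is_polytope A -> is_convex A.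
Proof. by move=> [k [p ->]]; exact: conv_image_convex. Qed.

Lemma minkowski_sum_convex (m : nat) (B : 'I_m -> set V) :
  (forall i, is_convex (B i)) -> is_convex (minkowski_sum B).
Proof.
move=> cB x y a [p [pB ->]] [q [qB ->]] a0 a1.
exists (fun i => p i + a *: (q i - p i)); split=> [i|]; first exact: cB.
by rewrite big_split /= -scaler_sumr sumrB.
Qed.

(** A polytope is the image of the compact standard simplex of weights under a
    linear map. *)
Lemma polytope_compact (A : set V) : is_polytope A -> compact A.
Proof.
move=> [k [p ->]].
pose f (a : 'rV[R]_k.+1) : V := \sum_i a 0 i *: p i.
pose D := [set a : 'rV[R]_k.+1 | forall i, `[0, 1]%classic (a 0 i)] `&`
          [set a : 'rV[R]_k.+1 | \sum_i a 0 i = 1].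
have -> : conv (range p) = f @` D.
  apply/seteqP; split=> [x /conv_range[b [b0 b1 ->]] | x [a [a01 a1] <-]].
    exists (\row_i b i); last by apply: eq_bigr => i _; rewrite mxE.
    split=> /=; last by rewrite -[RHS]b1; apply: eq_bigr => i _; rewrite mxE.
    move=> i; rewrite mxE in_itv /= b0 /= -b1 (bigD1 i) //= lerDl.
    by apply: sumr_ge0.
  apply/conv_range; exists (fun i => a 0 i); split=> // i.
  by have := a01 i; rewrite /= in_itv => /andP[].
apply: continuous_compact.
  apply: continuous_subspaceT; apply: continuous_big => [|i _ a].
    exact: add_continuous.
  exact: cvgZr_tmp (@coord_continuous _ _ _ 0 i a).
apply: compact_closedI.
  by have := (@rV_compact R k.+1 (fun=> `[0%R, 1%R]%classic)); apply=> _; exact: segment_compact.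
have := @preimage_closed _ _ (fun a : 'rV[R]_k.+1 => \sum_i a 0 i) [set y | y = 1]; apply.
  move=> a _; apply: continuous_big a => [|i _ a]; first exact: add_continuous.
  exact: coord_continuous.
exact: closed_eq.
Qed.

End Hull.

(** * The nerve of the cells that meet a convex set *)

Lemma ltn_count (T : eqType) (a b : pred T) (s : seq T) x :
  x \in s -> subpred a b -> b x -> ~~ a x -> (count a s < count b s)%N.
Proof.
move=> xs ab bx ax; elim: s xs => //= y s IH; rewrite inE => /predU1P[<-|/IH lt].
  by rewrite bx (negbTE ax) ltnS; exact: sub_count.
by rewrite -addnS leq_add //; case: (a y) (ab y) => // ->.
Qed.

Section Nerve.
Local Open Scope classical_set_scope.
Variables (R : realType) (n : nat) (K : fieldType).
Local Notation V := 'rV[R]_n.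
Variables (cells : seq (set V)) (P : set V).
Hypothesis cellP : forall s, s \in cells -> is_convex s /\ compact s.
Hypothesis cellI : forall s t, s \in cells -> t \in cells ->
  s `&` t !=set0 -> s `&` t \in cells.
Hypothesis convP : is_convex P.
Hypothesis coverP : forall x, P x <-> exists2 s, s \in cells & s x.

(** Repetitions and any order are allowed in the lists.  The point x is asked to
    lie in P so that the empty list belongs to the nerve only if C meets P. *)
Definition nerve (C : set V) (t : seq (set V)) : Prop :=
  (forall s, s \in t -> s \in cells) /\
  exists x, [/\ P x, C x & forall s, s \in t -> s x].

Definition meets (C s : set V) : bool := `[< s `&` C !=set0 >].

Lemma nerve_subseq C u t : subseq u t -> nerve C t -> nerve C u.
Proof.
move=> /mem_subseq ut [tc [x [Px Cx xt]]].
by split=> [s /ut/tc // | ]; exists x; split=> // s /ut/xt.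
Qed.

Lemma nerve_sub C C' t : C `<=` C' -> nerve C t -> nerve C' t.
Proof. by move=> CC' [tc [x [Px /CC' Cx xt]]]; split=> //; exists x. Qed.

(** The intersection of the cells in the list, of P and of C is convex: if it has
    points on both sides of a hyperplane, the segment between them crosses it. *)
Lemma nerve_halfspaces C (f : V) r t : is_convex C ->
  nerve (C `&` [set x | dot f x <= r]) t ->
  nerve (C `&` [set x | r <= dot f x]) t ->
  nerve (C `&` [set x | dot f x <= r] `&` [set x | r <= dot f x]) t.
Proof.
move=> cC [tc [x [Px [Cx /= fx] xt]]] [_ [y [Py [Cy /= fy] yt]]].
have [a [a0 a1 fa]] : exists a, [/\ 0 <= a, a <= 1
    & dot f (x + a *: (y - x)) = r].
  have [xy|xy] := eqVneq (dot f x) (dot f y).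
    exists 0; rewrite lexx ler01 scale0r addr0; split=> //; apply/eqP.
    by rewrite eq_le fx xy fy.
  have d0 : 0 < dot f y - dot f x.
    by rewrite subr_gt0 lt_neqAle xy (le_trans fx fy).
  exists ((r - dot f x) / (dot f y - dot f x)); split.
  - by rewrite divr_ge0 ?subr_ge0 // (le_trans fx fy).
  - by rewrite ler_pdivrMr // mul1r lerD2r.
  - by rewrite dotDr dotZr dotBr divfK ?gt_eqF // subrKC.
split=> //; exists (x + a *: (y - x)); split; first exact: convP.
  by split; [split; [exact: cC|]|]; rewrite /= fa.
move=> s st; have [cs _] := cellP (tc s st).
by apply: cs => //; [exact: xt | exact: yt].
Qed.

Lemma nerve_split C (f : V) r t : nerve C t ->
  nerve (C `&` [set x | dot f x <= r]) t \/
  nerve (C `&` [set x | r <= dot f x]) t.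
Proof.
move=> [tc [x [Px Cx xt]]]; have [fx|/ltW fx] := leP (dot f x) r.
  by left; split=> //; exists x.
by right; split=> //; exists x.
Qed.

Definition nerve_acyclic C := forall phi : seq (set V) -> K,
  (forall t, nerve C t -> delta phi t = 0) ->
  exists psi, forall t, nerve C t -> phi t = delta psi t.

(** A smallest cell among those meeting C can be prepended to every list of the
    nerve. *)
Lemma nerve_cone C s0 : s0 \in cells -> s0 `&` C !=set0 ->
  (forall s, s \in cells -> meets C s -> s0 `<=` s) -> nerve_acyclic C.
Proof.
move=> s0c [x0 [s0x Cx0]] s0min phi hphi.
exists (fun u => phi (s0 :: u)) => t Ct; rewrite delta_cone hphi ?subr0 //.
case: Ct => tc [x [Px Cx xt]]; split=> [s|].
  by rewrite inE => /predU1P[->|/tc].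
exists x0; split=> //; first by apply/coverP; exists s0.
move=> s; rewrite inE => /predU1P[->//|st].
by apply: (s0min s) => //; [exact: tc | apply/asboolP; exists x; split=> //; exact: xt].
Qed.

(** Mayer-Vietoris: two primitives differ on the intersection by a cocycle, whose
    primitive chi corrects one of them. *)
Lemma nerve_glue (C1 C2 C12 C : set V) :
  C12 `<=` C1 -> C12 `<=` C2 -> C1 `<=` C -> C2 `<=` C ->
  (forall t, nerve C1 t -> nerve C2 t -> nerve C12 t) ->
  (forall t, nerve C t -> nerve C1 t \/ nerve C2 t) ->
  nerve_acyclic C1 -> nerve_acyclic C2 -> nerve_acyclic C12 -> nerve_acyclic C.
Proof.
move=> s1 s2 sC1 sC2 hI hU a1 a2 a12 phi hphi.
have [p1 h1] := a1 phi (fun t h => hphi t (nerve_sub sC1 h)).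
have [p2 h2] := a2 phi (fun t h => hphi t (nerve_sub sC2 h)).
have [|chi hchi] := a12 (fun u => p2 u - p1 u).
  move=> t h; rewrite deltaB -h1 -?h2 ?subrr //; exact: nerve_sub h.
exists (fun u => if `[< nerve C1 u >] then p1 u else p2 u - delta chi u) => t Ct.
have [C1t|C2t] := hU t Ct.
  rewrite h1 //; apply: delta_ext => u ut _.
  by rewrite asboolT //; exact: nerve_subseq C1t.
rewrite h2 // -[LHS]subr0 -[X in _ - X](delta_delta chi t) -deltaB.
apply: delta_ext => u ut _; case: asboolP => // C1u.
rewrite -hchi ?subKr //; apply: hI => //; exact: nerve_subseq C2t.
Qed.

(** By induction on the number of cells that meet C.  If two of them, s and t, do
    not meet inside C, a hyperplane strictly separates their traces on C; the
    halves of C, and their common boundary, each miss s or t.  Otherwise the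
    cells that meet C are closed under pairwise intersection, so that there is
    a smallest one. *)
Lemma convex_nerve_acyclic C : closed C -> is_convex C -> P `&` C !=set0 ->
  nerve_acyclic C.
Proof.
have [N] := ubnP (count (meets C) cells).
elim: N C => // N IH C; rewrite ltnS => CN clC cC PC.
have [allI|] := pselect (forall s t, s \in cells -> t \in cells ->
    meets C s -> meets C t -> meets C (s `&` t)).
  have [s0 [s0c s0C s0min]] : exists s0, [/\ s0 \in cells, meets C s0 &
      forall s, s \in [seq s <- cells | meets C s] -> s0 `<=` s].
    have : {subset [seq s <- cells | meets C s] <= [seq s <- cells | meets C s]}.
      by [].
    move: {1 3}[seq s <- cells | meets C s]; elim=> [_|s l IHl ls].
      have [x [/coverP[s sc sx] Cx]] := PC.
      by exists s; split=> //; apply/asboolP; exists x.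
    have [|s0 [s0c s0C s0min]] := IHl.
      by move=> u ul; apply: ls; rewrite inE ul orbT.
    have : s \in s :: l by rewrite mem_head.
    move=> /ls; rewrite mem_filter => /andP[sC sc].
    have sI : meets C (s0 `&` s) by exact: allI.
    exists (s0 `&` s); split=> //.
      by apply: cellI => //; move/asboolP: sI => [x [? _]]; exists x.
    by move=> u; rewrite inE => /predU1P[->|/s0min h] x [] // /h.
  apply: (nerve_cone s0c); first exact/asboolP.
  by move=> s sc sC; apply: s0min; rewrite mem_filter sC.
move=> /existsNP[s /existsNP[t /not_implyP[sc /not_implyP[tc]]]].
move=> /not_implyP[sC /not_implyP[tC stC]].
have [cs ks] := cellP sc; have [ct kt] := cellP tc.
have st0 : (s `&` C) `&` (t `&` C) = set0.
  rewrite -subset0 => x [[sx Cx] [tx _]]; apply: stC.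
  by apply/asboolP; exists x.
have [f [r [hs ht]]] := strict_separation (compact_closedI ks clC)
  (compact_closedI kt clC) (is_convexI cs cC) (is_convexI ct cC)
  (elimT (asboolP _) sC) (elimT (asboolP _) tC) st0.
have PsC u : u \in cells -> u `&` C !=set0 -> exists x, [/\ P x, u x & C x].
  by move=> uc [x [ux Cx]]; exists x; split=> //; apply/coverP; exists u.
have [x [Px sx Cx]] := PsC _ sc (elimT (asboolP _) sC).
have [y [Py ty Cy]] := PsC _ tc (elimT (asboolP _) tC).
have fx : dot f x < r by exact: hs.
have fy : r < dot f y by exact: ht.
pose C1 := C `&` [set x | dot f x <= r]; pose C2 := C `&` [set x | r <= dot f x].
pose C12 := C1 `&` [set x | r <= dot f x].
have nC1t : ~~ meets C1 t.
  apply/asboolP => -[z [tz [Cz /= fz]]].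
  by have := ht z (conj tz Cz); rewrite ltNge fz.
have nC2s : ~~ meets C2 s.
  apply/asboolP => -[z [sz [Cz /= fz]]].
  by have := hs z (conj sz Cz); rewrite ltNge fz.
have sub C' : C' `<=` C -> subpred (meets C') (meets C).
  by move=> C'C u /asboolP[z [uz /C'C Cz]]; apply/asboolP; exists z.
have cl1 : closed C1 by apply: closedI => //; exact: halfspace_le_closed.
have cl2 : closed C2 by apply: closedI => //; exact: halfspace_ge_closed.
have cv1 : is_convex C1 by apply: is_convexI => //; exact: halfspace_le_convex.
have cv2 : is_convex C2 by apply: is_convexI => //; exact: halfspace_ge_convex.
have [_ [z [Pz Cz _]]] : nerve C12 [::].
  apply: nerve_halfspaces => //; split=> //.
    by exists x; split=> //; split=> //=; exact: ltW.
  by exists y; split=> //; split=> //=; exact: ltW.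
apply: (@nerve_glue C1 C2 C12 C).
- by move=> u [].
- by move=> u [[Cu _] fu].
- by move=> u [].
- by move=> u [].
- by move=> u; exact: nerve_halfspaces.
- by move=> u; exact: nerve_split.
- apply: IH => //; last by exists x; split=> //; split=> //=; exact: ltW.
  by apply: leq_trans CN; apply: (ltn_count tc) => //; apply: sub => u [].
- apply: IH => //; last by exists y; split=> //; split=> //=; exact: ltW.
  by apply: leq_trans CN; apply: (ltn_count sc) => //; apply: sub => u [].
- apply: IH => //; last by exists z.
  + apply: leq_trans CN; apply: (ltn_count tc) => //; first by apply: sub => u [[]].
    by apply: contra nC1t => /asboolP[u [tu [C1u _]]]; apply/asboolP; exists u.
  + by apply: closedI => //; exact: halfspace_ge_closed.
  + by apply: is_convexI => //; exact: halfspace_ge_convex.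
Qed.

End Nerve.

(** * Finite linear systems *)

Section Solve.
Variables (R : fieldType) (P Q : finType) (M : P -> Q -> R).

Let A : 'M[R]_(#|P|, #|Q|) := \matrix_(i, j) M (enum_val i) (enum_val j).

(** Rows that are linearly independent form a matrix with a right inverse. *)
Lemma solvable_of_free :
  (forall u : P -> R, (forall q, \sum_p u p * M p q = 0) -> forall p, u p = 0) ->
  forall g : P -> R, exists a : Q -> R, forall p, \sum_q M p q * a q = g p.
Proof.
move=> free g; have Afree : row_free A.
  rewrite -kermx_eq0; apply/eqP/row_matrixP => i; rewrite row0.
  set v := row i _; have vA : v *m A = 0.
    by apply/sub_kermxP; exact: row_sub.
  apply/rowP => k; rewrite [RHS]mxE.
  have := free (fun p => v 0 (enum_rank p)) _ (enum_val k); rewrite enum_valK.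
  apply=> q.
  move/rowP/(_ (enum_rank q)): vA; rewrite mxE [RHS]mxE => e0; rewrite -[RHS]e0.
  rewrite sum_enum_val; apply: eq_bigr => j _.
  by rewrite [A _ _]mxE enum_valK enum_rankK.
pose b := pinvmx A *m (\col_i g (enum_val i)).
exists (fun q => b (enum_rank q) 0) => p.
have /colP/(_ (enum_rank p)) : A *m b = \col_i g (enum_val i).
  by rewrite /b mulmxA mulmxVp // mul1mx.
rewrite !mxE enum_rankK => <-; rewrite sum_enum_val; apply: eq_bigr => j _.
by rewrite [A _ _]mxE enum_valK enum_rankK.
Qed.

Lemma nonzero_of_underdetermined : (#|Q| < #|P|)%N ->
  exists u : P -> R, (exists p, u p != 0) /\ forall q, \sum_p u p * M p q = 0.
Proof.
move=> QP; have : kermx A != 0.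
  rewrite -mxrank_eq0 mxrank_ker subn_eq0 -ltnNge.
  exact: leq_ltn_trans (rank_leq_col A) QP.
case/rowV0Pn => v /sub_kermxP vA v0; exists (fun p => v 0 (enum_rank p)); split.
  have [k vk] : exists k, v 0 k != 0.
    apply/existsP; apply: contraNT v0 => /existsPn h.
    by apply/eqP/rowP => k; rewrite mxE; apply/eqP/negPn; exact: h.
  by exists (enum_val k); rewrite enum_valK.
move=> q; move/rowP/(_ (enum_rank q)): vA; rewrite mxE [RHS]mxE => e0; rewrite -[RHS]e0.
rewrite sum_enum_val; apply: eq_bigr => j _.
by rewrite [A _ _]mxE enum_valK enum_rankK.
Qed.

End Solve.

(** * Minkowski cells of bipartite graphs and their faces *)

Section MixedCells.
Local Open Scope classical_set_scope.
Variables (R : realType) (m n : nat).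
Local Notation V := 'rV[R]_n.
Local Notation E := ('I_m * 'I_n)%type.
Local Notation W := 'M[R]_(m, n).
Implicit Types (S T : {set E}) (w : W) (x v : V) (g : 'I_m -> 'I_n).

(** A matrix w of weights on the pairs (i, j) stands for the tuple of its rows,
    and its column sums are the coordinates of the sum of that tuple. *)
Definition colsum w : V := \row_j \sum_i w i j.

Definition supported w T := forall e, e \notin T -> w e.1 e.2 = 0.

(** The Minkowski sum over i of the simplices conv {e_j : (i, j) in T}, see
    [mcell_minkowski]. *)
Definition mcell T : set V :=
  [set x | exists w, [/\ forall i j, 0 <= w i j, supported w T,
     forall i, \sum_j w i j = 1 & x = colsum w]].

(** Every summand is nonempty. *)
Definition spanning T := [forall i, exists j, (i, j) \in T].

(** A matrix supported on T with vanishing row and column sums is a circulation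
    on the bipartite graph T, and only forests have no nonzero circulation.  The
    row sums being zero, the rows are directions of the summands, so this is
    affine independence of the summands. *)
Definition forest T := forall w, supported w T ->
  (forall i, \sum_j w i j = 0) -> colsum w = 0 -> w = 0.

Lemma sum_pair (U : nmodType) (G : E -> U) :
  \sum_e G e = \sum_i \sum_j G (i, j).
Proof. by rewrite pair_bigA; apply: eq_bigr => -[]. Qed.

Lemma spanningP T : reflect (exists g, forall i, (i, g i) \in T) (spanning T).
Proof.
apply: (iffP forallP) => [h|[g gT] i]; last by apply/existsP; exists (g i).
have /choice[g gT] : forall i, exists j, (i, j) \in T.
  by move=> i; apply/existsP; exact: h.
by exists g.
Qed.

Lemma spanning_through T i j : spanning T -> (i, j) \in T ->
  exists g, (forall k, (k, g k) \in T) /\ g i = j.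
Proof.
move=> /spanningP[g gT] ijT; exists (fun k => if k == i then j else g k).
by split=> [k|]; rewrite ?eqxx //; case: eqP => [->|_].
Qed.

Lemma colsumB w w' : colsum (w - w') = colsum w - colsum w'.
Proof. by apply/rowP => j; rewrite !mxE -sumrB; apply: eq_bigr => i _; rewrite !mxE. Qed.

Lemma colsumD w w' : colsum (w + w') = colsum w + colsum w'.
Proof. by apply/rowP => j; rewrite !mxE -big_split; apply: eq_bigr => i _; rewrite !mxE. Qed.

Lemma colsumZ k w : colsum (k *: w) = k *: colsum w.
Proof. by apply/rowP => j; rewrite !mxE mulr_sumr; apply: eq_bigr => i _; rewrite !mxE. Qed.

Lemma forest_sub S T : T \subset S -> forest S -> forest T.
Proof.
move=> TS fS w wT; apply: fS => e eS; apply: wT.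
by apply: contra eS => /(fintype.subsetP TS).
Qed.

(** Points of the cell have a unique decomposition into points of the summands. *)
Lemma forest_inj S w w' : forest S -> supported w S -> supported w' S ->
  (forall i, \sum_j w i j = \sum_j w' i j) -> colsum w = colsum w' -> w = w'.
Proof.
move=> fS wS w'S hr hc; apply/eqP; rewrite -subr_eq0; apply/eqP/fS.
- by move=> e eS; rewrite !mxE wS // w'S // subrr.
- move=> i; under eq_bigr do rewrite !mxE.
  by rewrite sumrB hr subrr.
- by rewrite colsumB hc subrr.
Qed.

Definition pt_weight g : W := \matrix_(i, j) (j == g i)%:R.

(** The vertex of the cell given by choosing e_(g i) in the i-th summand. *)
Definition pt g : V := colsum (pt_weight g).

Lemma pt_weight_row g i : \sum_j pt_weight g i j = 1.
Proof.
by rewrite (bigD1 (g i)) //= mxE eqxx big1 ?addr0 // => j /negbTE jg; rewrite mxE jg.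
Qed.

Lemma pt_weight_supported g T : (forall i, (i, g i) \in T) ->
  supported (pt_weight g) T.
Proof.
move=> gT [i j] /= ijT; rewrite mxE; case: eqP => // jg.
by rewrite jg gT in ijT.
Qed.

Lemma mcell_pt g T : (forall i, (i, g i) \in T) -> mcell T (pt g).
Proof.
move=> gT; exists (pt_weight g); split=> //.
- by move=> i j; rewrite mxE ler0n.
- exact: pt_weight_supported.
- exact: pt_weight_row.
Qed.

Lemma mcell_neq0 T : spanning T -> mcell T !=set0.
Proof. by case/spanningP => g gT; exists (pt g); exact: mcell_pt. Qed.

Lemma mcell_spanning T : mcell T !=set0 -> spanning T.
Proof.
case=> x [w [w0 wT w1 _]]; apply/forallP => i; apply/existsP.
apply: contrapT => nT; move: (w1 i); rewrite big1 => [/eqP|j _].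
  by rewrite eq_sym oner_eq0.
by apply: (wT (i, j)); apply/negP => ijT; apply: nT; exists j.
Qed.

Lemma mcell_mono S T : T \subset S -> mcell T `<=` mcell S.
Proof.
move=> TS x [w [w0 wT w1 xE]]; exists w; split=> // e eS; apply: wT.
by apply: contra eS => /(fintype.subsetP TS).
Qed.

Lemma dot_colsum (a : V) w : dot a (colsum w) = \sum_i \sum_j w i j * a 0 j.
Proof.
rewrite /dot exchange_big; apply: eq_bigr => j _.
by rewrite mxE mulr_sumr; apply: eq_bigr => i _; rewrite mulrC.
Qed.

(** If c_i bounds a on the i-th summand, the last sum measures how far the point
    is from being a maximizer of a. *)
Lemma dot_deficit (a : V) (c : 'I_m -> R) w : (forall i, \sum_j w i j = 1) ->
  dot a (colsum w) = \sum_i c i - \sum_(e : E) w e.1 e.2 * (c e.1 - a 0 e.2).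
Proof.
move=> w1; rewrite dot_colsum sum_pair /=.
rewrite -sumrB; apply: eq_bigr => i _.
rewrite -{1}[c i]mul1r -(w1 i) mulr_suml -sumrB; apply: eq_bigr => j _.
by ring.
Qed.

Definition maximizers (a : V) (A : set V) : set V :=
  [set x | A x /\ forall y, A y -> dot a y <= dot a x].

(** The deficit [dot_deficit] is a sum of nonnegative terms, which all vanish
    exactly when the weights are supported on the edges where c_i is attained. *)
Lemma mcell_maximizers S T (a : V) (c : 'I_m -> R) : T \subset S -> spanning T ->
  (forall e, e \in T -> a 0 e.2 = c e.1) ->
  (forall e, e \in S -> e \notin T -> a 0 e.2 < c e.1) ->
  maximizers a (mcell S) = mcell T.
Proof.
move=> TS /spanningP[g gT] aT aS.
have le_ac e : e \in S -> 0 <= c e.1 - a 0 e.2.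
  move=> eS; rewrite subr_ge0; have [/aT->//|/aS h] := boolP (e \in T).
  exact: ltW (h eS).
have term0 w : (forall i j, 0 <= w i j) -> supported w S -> forall e,
    0 <= w e.1 e.2 * (c e.1 - a 0 e.2).
  move=> w0 wS e; have [eS|eS] := boolP (e \in S).
    by rewrite mulr_ge0 // le_ac.
  by rewrite wS // mul0r.
have onT w : supported w T -> (forall i, \sum_j w i j = 1) ->
    dot a (colsum w) = \sum_i c i.
  move=> wT w1; rewrite (dot_deficit _ c) // [X in _ - X]big1 ?subr0 // => e _.
  have [/aT->|/wT->] := boolP (e \in T); last by rewrite mul0r.
  by rewrite subrr mulr0.
apply/seteqP; split=> [x [[w [w0 wS w1 ->]] xmax] | x].
  exists w; split=> // e eT.
  have := xmax _ (mcell_mono TS (mcell_pt gT)).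
  rewrite /pt (onT (pt_weight g)); [|exact: pt_weight_supported|exact: pt_weight_row].
  rewrite (dot_deficit _ c) // lerDl oppr_ge0 => s0.
  have /eqP : w e.1 e.2 * (c e.1 - a 0 e.2) = 0.
    apply: (psumr_eq0P (P := xpredT) (F := fun e : E => w e.1 e.2 * (c e.1 - a 0 e.2))) => //.
      by move=> *; exact: term0.
    by apply/eqP; rewrite eq_le s0 sumr_ge0 // => *; exact: term0.
  rewrite mulf_eq0 => /orP[/eqP//|]; have [eS|/wS//] := boolP (e \in S).
  by rewrite subr_eq0 gt_eqF // aS.
move=> xT; split; first exact: mcell_mono xT.
case: xT => w [w0 wT w1 ->] y [w' [w'0 w'S w'1 ->]].
rewrite (onT w) // (dot_deficit _ c) // gerDl oppr_le0 sumr_ge0 // => *.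
exact: term0.
Qed.

(** The edges of a forest impose independent conditions on the potentials, by
    duality with the absence of circulations. *)
Lemma forest_potential S (h : E -> R) : forest S ->
  exists (a : V) (c : 'I_m -> R), forall e, e \in S -> c e.1 - a 0 e.2 = h e.
Proof.
move=> fS; pose P := {e : E | e \in S}; pose Q := ('I_m + 'I_n)%type.
pose M (p : P) (q : Q) : R :=
  match q with inl i => ((val p).1 == i)%:R | inr j => - ((val p).2 == j)%:R end.
have sumP (F : E -> R) : \sum_(p : P) F (val p) = \sum_(e in S) F e.
  by rewrite [RHS]big_sub.
have [|z hz] := @solvable_of_free _ P Q M _ (fun p => h (val p)).
  move=> u hu.
  pose u' e := if insub e is Some p then u p else 0.
  have u'E p : u' (val p) = u p by rewrite /u' valK.
  pose w : W := \matrix_(i, j) u' (i, j).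
  have wS : supported w S.
    by move=> [i j] eS; rewrite mxE /u' insubF //; exact: negbTE.
  suff w0 : w = 0.
    by move=> p; have := congr1 (fun w : W => w (val p).1 (val p).2) w0;
      rewrite !mxE -surjective_pairing u'E.
  have full (G : E -> R) : \sum_p u p * G (val p) = \sum_(e : E) u' e * G e.
    under eq_bigr do rewrite -u'E.
    rewrite (sumP (fun e => u' e * G e)) big_mkcond; apply: eq_bigr => e _.
    by case: ifPn => // eS; rewrite /u' insubF ?mul0r //; exact: negbTE.
  apply: fS => // [i|].
    have := hu (inl i); rewrite (full (fun e => (e.1 == i)%:R)) => e0; rewrite -[RHS]e0.
    rewrite sum_pair (bigD1 i) //=.
    rewrite [X in _ + X]big1 ?addr0 => [|k ki].
      by apply: eq_bigr => j _; rewrite mxE eqxx mulr1.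
    by apply: big1 => j _; rewrite (negbTE ki) mulr0.
  apply/rowP => j; rewrite !mxE.
  have := hu (inr j); rewrite (full (fun e => - (e.2 == j)%:R)) => /eqP.
  under eq_bigr do rewrite mulrN.
  rewrite sumrN oppr_eq0 => /eqP e0; rewrite -[RHS]e0.
  rewrite sum_pair exchange_big /=.
  rewrite (bigD1 j) //= [X in _ + X]big1 ?addr0 => [|k kj].
    by apply: eq_bigr => i _; rewrite mxE eqxx mulr1.
  by apply: big1 => i _; rewrite (negbTE kj) mulr0.
exists (\row_j z (inr j)), (fun i => z (inl i)) => e eS.
have := hz (Sub e eS); rewrite big_sumType /= => <-; rewrite mxE.
rewrite (bigD1 e.1) //= eqxx mul1r big1 ?addr0 => [|i /negbTE ie]; last first.
  by rewrite eq_sym ie mul0r.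
congr (_ + _); rewrite (bigD1 e.2) //= eqxx mulN1r big1 ?addr0 // => j /negbTE je.
by rewrite eq_sym je oppr0 mul0r.
Qed.

(** A potential that is tight on T and has slack one on the other edges of S
    exposes the face. *)
Lemma mcell_face S T : forest S -> T \subset S -> spanning T ->
  face (mcell T) (mcell S).
Proof.
move=> fS TS sT.
have [a [c hac]] := @forest_potential S (fun e => (e \notin T)%:R) fS.
exists a; symmetry; apply: (@mcell_maximizers S T a c) => // e.
  by move=> eT; have /eqP := hac e (fintype.subsetP TS e eT); rewrite eT subr_eq0 => /eqP.
by move=> eS eT; rewrite -subr_gt0 hac // eT ltr01.
Qed.

(** A functional exposes in each summand the face spanned by the e_j with the
    largest coefficient. *)
Lemma face_mcell S F : spanning S -> face F (mcell S) ->
  exists T, [/\ T \subset S, spanning T & F = mcell T].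
Proof.
move=> /spanningP[g0 gS] [a ->].
pose g i := [arg max_(j > g0 i | (i, j) \in S) a 0 j]%O.
pose c i := a 0 (g i).
pose T := [set e in S | a 0 e.2 == c e.1].
have gP i : (i, g i) \in S /\ forall j, (i, j) \in S -> a 0 j <= c i.
  by rewrite /c /g; case: arg_maxP.
have TS : T \subset S by apply/fintype.subsetP => e; rewrite inE => /andP[].
have sT : spanning T.
  by apply/spanningP; exists g => i; rewrite inE (gP i).1 /= eqxx.
exists T; split=> //; apply: (@mcell_maximizers S T a c) => // e.
  by rewrite inE => /andP[_ /eqP].
move=> eS; rewrite inE eS /= lt_neqAle => -> /=.
by apply: (gP e.1).2; rewrite -surjective_pairing.
Qed.

Lemma mcell_subset S T T' : forest S -> T \subset S -> T' \subset S ->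
  spanning T -> mcell T `<=` mcell T' -> T \subset T'.
Proof.
move=> fS TS T'S sT TT'; apply/fintype.subsetP => -[i j] ijT.
have [g [gT gi]] := spanning_through sT ijT.
have [w [w0 wT' w1 wE]] := TT' _ (mcell_pt gT).
apply: contraT => /wT'/=.
rewrite -(_ : pt_weight g = w); first by rewrite mxE gi eqxx => /eqP; rewrite oner_eq0.
apply: (forest_inj fS) => //.
- by apply: pt_weight_supported => k; exact: (fintype.subsetP TS).
- by move=> e eS; apply: wT'; apply: contra eS => /(fintype.subsetP T'S).
- by move=> k; rewrite pt_weight_row w1.
Qed.

Lemma mcell_inj S T T' : forest S -> T \subset S -> T' \subset S ->
  spanning T -> spanning T' -> mcell T = mcell T' -> T = T'.
Proof.
move=> fS TS T'S sT sT' TT'; apply/eqP; rewrite finset.eqEsubset.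
by apply/andP; split; apply: (mcell_subset fS) => //; rewrite TT'.
Qed.

End MixedCells.

(** * Directions and dimensions *)

Section Directions.
Local Open Scope classical_set_scope.
Variables (R : realType) (n : nat).
Local Notation V := 'rV[R]_n.
Implicit Types (A : set V) (x v : V).

Lemma direction_sub A x y : A x -> A y -> direction A (x - y).
Proof.
move=> Ax Ay; exists 1%N, (fun=> 1), (fun=> x), (fun=> y).
by split=> //; rewrite big_ord1 scale1r.
Qed.

Lemma direction_comb A (J : finType) (c : J -> R) (f : J -> V) :
  (forall j, direction A (f j)) -> direction A (\sum_j c j *: f j).
Proof.
move=> dirf; pose comb := {k : nat & ('I_k -> R) * ('I_k -> V) * ('I_k -> V)}%type.
have /choice[d hd] : forall j, exists d : comb,
    (forall i, A ((tagged d).1.2 i) /\ A ((tagged d).2 i)) /\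
    f j = \sum_i (tagged d).1.1 i *: ((tagged d).1.2 i - (tagged d).2 i).
  move=> j; have [k [a [x [y h]]]] := dirf j.
  by exists (Tagged (fun k => ('I_k -> R) * ('I_k -> V) * ('I_k -> V))%type (a, x, y)).
pose N : finType := {j : J & 'I_(tag (d j))}.
pose a (p : N) := (tagged (d (tag p))).1.1 (tagged p).
pose x (p : N) := (tagged (d (tag p))).1.2 (tagged p).
pose y (p : N) := (tagged (d (tag p))).2 (tagged p).
exists #|N|, (fun i => c (tag (enum_val i)) * a (enum_val i)),
  (fun i => x (enum_val i)), (fun i => y (enum_val i)).
split=> [i|]; first exact: (hd (tag (enum_val i))).1.
rewrite -(sum_enum_val (fun p : N => (c (tag p) * a p) *: (x p - y p))).
under [LHS]eq_bigr => j _.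
  by rewrite (hd j).2 scaler_sumr; under eq_bigr do rewrite scalerA; over.
by rewrite sig_big_dep.
Qed.

(** A family of independent directions of maximal size spans all of them, since
    otherwise one more row could be added. *)
Lemma direction_matrix A : exists k (M : 'M[R]_(k, n)),
  [/\ row_free M, forall v, direction A v <-> (v <= M)%MS & dim A = k].
Proof.
pose Q k := exists M : 'M[R]_(k, n), row_free M /\ forall i, direction A (row i M).
have Q0 : Q 0%N.
  by exists 0; split=> [|[]//]; rewrite /row_free mxrank0.
have [M [Mfree MA]] : Q (dim A).
  have [k Qk kmax] : exists2 k : 'I_n.+1, Q k & dim A = k.
    have Qpos : (0 < #|[pred k : 'I_n.+1 | `[< Q k >]]|)%N.
      by apply/card_gt0P; exists ord0; exact: (asboolT Q0).
    have [k] := eq_bigmax_cond (fun k : 'I_n.+1 => k : nat) Qpos.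
    move=> /asboolP Qk kE; exists k; [exact: Qk | rewrite -[RHS]kE].
    by apply: eq_bigl => i; rewrite inE.
  by rewrite kmax.
exists (dim A), M; split=> // v; split=> [Av|/submxP[D ->]]; last first.
  rewrite mulmx_sum_row; exact: direction_comb.
apply: contraT => nvM; pose N := col_mx v M.
have ltMN : (M < N)%MS.
  rewrite ltmxE /N; apply/andP; split; first by rewrite -addsmxE addsmxSr.
  by apply: contra nvM; apply: submx_trans; rewrite -addsmxE addsmxSl.
have rN : row_free N.
  rewrite /row_free eqn_leq rank_leq_row /=.
  by have := rank_ltmx ltMN; rewrite (eqP Mfree).
have dn : ((dim A).+1 < n.+1)%N.
  by have := rank_leq_col N; rewrite (eqP rN).
have Qd : Q (dim A).+1.
  exists N; split=> // i; move: (i : 'I_(1 + dim A)) => {}i.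
  rewrite -[i]fintype.splitK; case: (fintype.split i) => j /=.
    change (direction A (row (lshift (dim A) j) (col_mx v M))).
    rewrite rowKu (_ : row j v = v); first exact: Av.
    by apply/rowP => l; rewrite mxE ord1.
  change (direction A (row (rshift 1 j) (col_mx v M))).
  by rewrite rowKd; exact: MA.
have : ((Ordinal dn : nat) <= dim A)%N.
  by apply: (leq_bigmax_cond (F := fun k : 'I_n.+1 => k : nat)); apply/asboolP.
by rewrite ltnn.
Qed.

Lemma dim_basis A (D : finType) (f : D -> V) :
  (forall u : D -> R, \sum_d u d *: f d = 0 -> forall d, u d = 0) ->
  (forall v, direction A v <-> exists u : D -> R, v = \sum_d u d *: f d) ->
  dim A = #|D|.
Proof.
move=> free span; have [k [M [Mf MA ->]]] := direction_matrix A.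
pose G : 'M[R]_(#|D|, n) := \matrix_i f (enum_val i).
have rG (u : D -> R) : \sum_d u d *: f d = \row_i u (enum_val i) *m G.
  rewrite mulmx_sum_row sum_enum_val; apply: eq_bigr => i _.
  by rewrite rowK mxE.
have Gf : row_free G.
  rewrite -kermx_eq0; apply/eqP/row_matrixP => i; rewrite row0.
  have /sub_kermxP := row_sub i (kermx G); move: (row i _) => v vG.
  apply/rowP => j; rewrite mxE.
  have := free (fun d => v 0 (enum_rank d)) _ (enum_val j); rewrite enum_valK.
  apply; rewrite rG -[RHS]vG; congr (_ *m _); apply/rowP => l.
  by rewrite mxE enum_valK.
have GM : (G :=: M)%MS.
  apply/eqmxP/andP; split; apply/rV_subP => v.
    case/submxP => u ->; apply/MA/span; exists (fun d => u 0 (enum_rank d)).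
    by rewrite rG; congr (_ *m _); apply/rowP => l; rewrite mxE enum_valK.
  by move=> /MA/span[u ->]; rewrite rG submxMl.
by rewrite -(eqP Mf) -GM (eqP Gf).
Qed.

End Directions.

Section MixedDirections.
Local Open Scope classical_set_scope.
Variables (R : realType) (m n : nat).
Local Notation V := 'rV[R]_n.
Local Notation E := ('I_m * 'I_n)%type.
Local Notation W := 'M[R]_(m, n).
Implicit Types (S T : {set E}) (w : W) (x v : V) (g : 'I_m -> 'I_n).
Local Notation mcell := (@mcell R m n).
Local Notation forest := (@forest R m n).

Lemma conv_unit (A : set 'I_n) x :
  conv [set delta_mx 0 j | j in A] x <->
  [/\ forall j, 0 <= x 0 j, forall j, ~ A j -> x 0 j = 0 & \sum_j x 0 j = 1].
Proof.
have rE (b : 'I_n -> R) : \sum_j b j *: delta_mx 0 j = \row_j b j.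
  by rewrite [RHS]row_sum_delta; apply: eq_bigr => j _; rewrite mxE.
rewrite conv_image; split=> [[b [b0 bA b1 ->]]|[x0 xA x1]].
  rewrite rE; split=> [j|j /bA|]; rewrite ?mxE //.
  by rewrite -[RHS]b1; apply: eq_bigr => j _; rewrite mxE.
exists (fun j => x 0 j); split=> //.
by rewrite rE; apply/rowP => j; rewrite mxE.
Qed.

Lemma mcell_minkowski T :
  minkowski_sum (fun i => conv [set delta_mx 0 j | j in [set j | (i, j) \in T]]) =
  mcell T.
Proof.
apply/seteqP; split=> [x [p [pT ->]]|x [w [w0 wT w1 ->]]].
  exists (\matrix_i p i); split.
  - by move=> i j; have /conv_unit[h _ _] := pT i; have := h j; rewrite mxE.
  - move=> [i j] ijT /=; have /conv_unit[_ h _] := pT i.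
    by rewrite mxE h //=; exact/negP.
  - move=> i; have /conv_unit[_ _ h] := pT i.
    by rewrite -[RHS]h; apply: eq_bigr => j _; rewrite mxE.
  - apply/rowP => j; rewrite mxE summxE; apply: eq_bigr => i _.
    by rewrite mxE.
exists (fun i => row i w); split.
  move=> i; apply/conv_unit; split=> [j|j /= /negP ijT|]; rewrite ?mxE //.
    exact: (wT (i, j)).
  by rewrite -(w1 i); apply: eq_bigr => j _; rewrite mxE.
by apply/rowP => j; rewrite mxE summxE; apply: eq_bigr => i _; rewrite mxE.
Qed.

(** For the converse, exchanging the edge of one row between two vertices gives
    the direction e_j - e_(g i), and these span the matrices with vanishing row
    sums. *)
Lemma direction_mcell T v : spanning T ->
  direction (mcell T) v <->
  exists w, [/\ supported w T, forall i, \sum_j w i j = 0 & v = colsum w].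
Proof.
move=> sT; split.
  move=> [k [a [x [y [xyT ->]]]]].
  have /choice[wx hx] : forall l, exists w, [/\ supported w T,
      forall i, \sum_j w i j = 1 & x l = colsum w].
    by move=> l; have [[w [_ ? ? ?]] _] := xyT l; exists w.
  have /choice[wy hy] : forall l, exists w, [/\ supported w T,
      forall i, \sum_j w i j = 1 & y l = colsum w].
    by move=> l; have [_ [w [_ ? ? ?]]] := xyT l; exists w.
  exists (\sum_l a l *: (wx l - wy l)); split.
  - move=> e eT; rewrite summxE big1 // => l _; rewrite !mxE.
    by have [-> // _ _] := hx l; have [-> // _ _] := hy l; rewrite subrr mulr0.
  - move=> i; under eq_bigr do rewrite summxE.
    rewrite exchange_big big1 //= => l _; under eq_bigr do rewrite !mxE.
    rewrite -mulr_sumr sumrB.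
    by have [_ -> _] := hx l; have [_ -> _] := hy l; rewrite subrr mulr0.
  - rewrite (big_morph (@colsum R m n) (@colsumD R m n) (id1 := 0)); last first.
      by apply/rowP => j; rewrite !mxE big1 // => i _; rewrite mxE.
    apply: eq_bigr => l _; rewrite colsumZ colsumB.
    by have [_ _ ->] := hx l; have [_ _ ->] := hy l.
move=> [w [wT wr ->]]; have /spanningP[g gT] := sT.
pose ge (e : E) i := if i == e.1 then e.2 else g i.
have -> : colsum w = \sum_(e : E) w e.1 e.2 *: (if e \in T then pt R (ge e) - pt R g else 0).
  have peq (e : E) : pt R (ge e) - pt R g = delta_mx 0 e.2 - delta_mx 0 (g e.1).
    rewrite /pt -colsumB; apply/rowP => j; rewrite mxE (bigD1 e.1) //= big1 => [|i ie].
      by rewrite addr0 !mxE /ge eqxx.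
    by rewrite !mxE /ge (negbTE ie) subrr.
  transitivity (\sum_(e : E) w e.1 e.2 *: (delta_mx 0 e.2 - delta_mx 0 (g e.1) : V)).
    rewrite sum_pair /=; under [RHS]eq_bigr => i _.
      under eq_bigr do rewrite scalerBr.
      rewrite sumrB -scaler_suml wr scale0r subr0; over.
    apply/rowP => j; rewrite mxE summxE; apply: eq_bigr => i _.
    rewrite summxE (bigD1 j) //= big1 => [|k kj]; rewrite !mxE eqxx /=.
      by rewrite eqxx mulr1 addr0.
    by rewrite eq_sym (negbTE kj) mulr0.
  apply: eq_bigr => e _; case: ifPn => [_|eT]; first by rewrite peq.
  by rewrite wT // !scale0r.
apply: direction_comb => e; case: ifPn => eT.
  apply: direction_sub; apply: mcell_pt => // i.
  by rewrite /ge; case: eqP => // ->; rewrite -surjective_pairing.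
rewrite -(subrr (pt R g)); apply: direction_sub; exact: mcell_pt.
Qed.

(** Fixing one edge per row, the other edges index a basis: the matrix with
    entry 1 at such an edge and -1 at the fixed edge of its row. *)
Lemma dim_mcell T : forest T -> spanning T -> (dim (mcell T) + m)%N = #|T|.
Proof.
move=> fT sT; have /spanningP[g gT] := sT.
pose B := [set e in T | e.2 != g e.1].
pose f (e : {x in B}) : V := delta_mx 0 (val e).2 - delta_mx 0 (g (val e).1).
pose ext (u : {x in B} -> R) (e : E) : R := if insub e is Some d then u d else 0.
have extE u (d : {x in B}) : ext u (val d) = u d by rewrite /ext valK.
have ext0 u e : e \notin B -> ext u e = 0.
  by move=> eB; rewrite /ext insubF //; exact: negbTE.
pose wt u : W := \matrix_(i, j) (ext u (i, j) - (j == g i)%:R * \sum_k ext u (i, k)).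
have wtT u : supported (wt u) T.
  move=> [i j] ijT; rewrite mxE ext0 /=; last first.
    by rewrite inE negb_and ijT.
  case: eqP => [jg|_]; last by rewrite mul0r subrr.
  by rewrite jg gT in ijT.
have wtr u i : \sum_j wt u i j = 0.
  under eq_bigr do rewrite mxE.
  rewrite sumrB -mulr_suml [X in _ - X * _](bigD1 (g i)) //= eqxx.
  rewrite [X in (_ + X) * _]big1 => [|j /negbTE->//].
  by rewrite addr0 mul1r subrr.
have wtc u : colsum (wt u) = \sum_d u d *: f d.
  have -> : \sum_d u d *: f d =
      \sum_(e : E) ext u e *: (delta_mx 0 e.2 - delta_mx 0 (g e.1)).
    under eq_bigr do rewrite -extE.
    rewrite -(big_sub (mem B) (fun e => ext u e *: (delta_mx 0 e.2 - delta_mx 0 (g e.1) : V))).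
    rewrite big_mkcond; apply: eq_bigr => e _.
    by case: ifPn => // eB; rewrite ext0 // scale0r.
  rewrite sum_pair; apply/rowP => j; rewrite mxE summxE; apply: eq_bigr => i _.
  rewrite summxE mxE /=.
  under [RHS]eq_bigr do rewrite !mxE eqxx /= mulrBr.
  rewrite sumrB; congr (_ - _).
    rewrite (bigD1 j) //= eqxx mulr1 big1 ?addr0 // => k kj.
    by rewrite eq_sym (negbTE kj) mulr0.
  by rewrite -mulr_suml mulrC.
have -> : dim (mcell T) = #|{: {x in B}}|.
  apply: (@dim_basis _ _ _ _ f).
    move=> u; rewrite -wtc => /(fT _ (wtT u) (wtr u)) w0 d.
    have := congr1 (fun w : W => w (val d).1 (val d).2) w0.
    have : val d \in B by exact: valP.
    rewrite inE !mxE => /andP[_ /negbTE->]; rewrite mul0r subr0.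
    by rewrite -surjective_pairing extE.
  move=> v; rewrite direction_mcell //; split=> [[w [wT wr ->]]|[u ->]]; last first.
    by exists (wt u); split.
  exists (fun d => w (val d).1 (val d).2); rewrite -wtc; congr colsum.
  set u := fun _ => _.
  have uE i j : j != g i -> ext u (i, j) = w i j.
    move=> jg; rewrite /ext; case: insubP => [d dB dE|]; first by rewrite /u dE.
    by rewrite inE /= jg andbT => /wT /= ->.
  have ug i : ext u (i, g i) = 0 by rewrite ext0 // inE /= eqxx andbF.
  apply/matrixP => i j; rewrite mxE; case: eqP => [->|/eqP jg]; last first.
    by rewrite mul0r subr0 uE.
  rewrite ug mul1r sub0r; apply/eqP; rewrite -addr_eq0; apply/eqP.
  rewrite -[RHS](wr i) (bigD1 (g i)) //= ug add0r [in RHS](bigD1 (g i)) //=.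
  by congr (_ + _); apply: eq_bigr => k; exact: uE.
rewrite card_sub -[in X in (_ + X)%N](card_ord m).
have -> : #|'I_m| = #|imset (fun i : 'I_m => (i, g i)) (mem 'I_m)|.
  by rewrite card_imset // => i j [].
rewrite -cardsUI [X in (_ + X)%N](_ : _ = 0%N) ?addn0; last first.
  apply/eqP; rewrite cards_eq0; apply/eqP/setP => e; rewrite !inE.
  by apply/negP => /andP[/andP[_ eg] /imsetP[i _ eE]]; rewrite eE /= eqxx in eg.
apply: eq_card => e; rewrite !inE; apply/orP/idP => [[/andP[]//|/imsetP[i _ ->]//]|eT].
have [eg|] := eqVneq e.2 (g e.1); last by left; rewrite eT.
by right; apply/imsetP; exists e.1 => //; rewrite -eg -surjective_pairing.
Qed.

End MixedDirections.

(** * Labels and degrees; cells of a fine mixed subdivision *)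

Section Labels.
Local Open Scope classical_set_scope.
Variables (R : realType) (m n : nat).
Local Notation V := 'rV[R]_n.
Local Notation E := ('I_m * 'I_n)%type.
Local Notation W := 'M[R]_(m, n).
Implicit Types (S T : {set E}) (w : W) (x v : V) (g : 'I_m -> 'I_n).
Local Notation mcell := (@mcell R m n).
Local Notation forest := (@forest R m n).

Definition degree S (j : 'I_n) : nat := #|finset (fun i => (i, j) \in S)|.

Lemma degree_mono S T j : T \subset S -> (degree T j <= degree S j)%N.
Proof.
move=> /fintype.subsetP TS; apply: subset_leq_card; apply/fintype.subsetP => i.
by rewrite !inE; exact: TS.
Qed.

Lemma pt_coord g j : pt R g 0 j = #|finset (fun i => g i == j)|%:R.
Proof.
rewrite mxE -sum1_card natr_sum [RHS]big_mkcond; apply: eq_bigr => i _.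
by rewrite mxE inE eq_sym; case: eqP.
Qed.

Lemma mcell_coord_le S x j : mcell S x -> x 0 j <= (degree S j)%:R.
Proof.
move=> [w [w0 wS w1 ->]]; rewrite mxE /degree -sum1_card natr_sum [leRHS]big_mkcond.
apply: ler_sum => i _; rewrite inE; case: ifPn => [_|/wS/= -> //].
by rewrite -(w1 i) (bigD1 j) //= lerDl sumr_ge0.
Qed.

(** A face that is a single point contains the vertex [pt] of any choice
    function in its graph; conversely the graph of g is a spanning subgraph,
    whose cell is one point. *)
Lemma vertices_mcell S v : forest S -> spanning S ->
  vertices (mcell S) v <-> exists g, (forall i, (i, g i) \in S) /\ v = pt R g.
Proof.
move=> fS sS; split=> [/(face_mcell sS)[T [TS /spanningP[g gT] vT]]|[g [gS ->]]].
  exists g; split=> [i|]; first exact: (fintype.subsetP TS).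
  by have : [set v] (pt R g) by [rewrite vT; exact: mcell_pt].
pose T : {set E} := finset (fun e => e.2 == g e.1).
have TS : T \subset S.
  by apply/fintype.subsetP => -[i j]; rewrite inE => /eqP /= ->.
have sT : spanning T by apply/spanningP; exists g => i; rewrite inE.
have := mcell_face fS TS sT; rewrite /vertices /=; congr (face _ _).
apply/seteqP; split=> [x xT|_ ->]; last by apply: mcell_pt => i; rewrite inE.
have xS := mcell_mono TS xT.
case: xT => w [w0 wT w1 ->]; rewrite /= /pt; congr colsum.
have w0' i j : j != g i -> w i j = 0 by move=> jg; apply: (wT (i, j)); rewrite inE.
apply/matrixP => i j; rewrite mxE; case: eqP => [->|/eqP/w0' //].
rewrite -(w1 i) (bigD1 (g i)) //= big1 ?addr0 // => k; exact: w0'.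
Qed.

Lemma divides_biglcm (I : choiceType) (A : set I) (F : I -> mpoly.multinom n) b :
  finite_set A ->
  divides (\big[@mpoly.mlcm n/@mpoly.mnm0 n]_(v \in A) F v) b <->
  forall u, A u -> divides (F u) b.
Proof.
move=> finA; have lem0 : divides (@mpoly.mnm0 n) b.
  by apply/mpoly.mnm_lepP => j; rewrite mpoly.mnm0E.
have big_seq (r : seq I) : divides (\big[@mpoly.mlcm n/@mpoly.mnm0 n]_(v <- r) F v) b <->
    forall u, u \in r -> divides (F u) b.
  elim: r => [|y r IH]; first by rewrite big_nil.
  rewrite big_cons /divides mpoly.lem_mlcm; split=> [/andP[yb /IH rb] v|h].
    by rewrite inE => /predU1P[->|/rb].
  apply/andP; split; first by apply: h; rewrite mem_head.
  by apply/IH => v vr; apply: h; rewrite inE vr orbT.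
rewrite big_seq; split=> [h v Av|h v].
  have [->//|Fv] := pselect (F v = @mpoly.mnm0 n).
  apply: h; rewrite in_finite_support; last exact: finite_setIl.
  by rewrite inE.
rewrite in_finite_support; last exact: finite_setIl.
by rewrite inE => -[Av _]; exact: h.
Qed.

(** The exponent of x_j in the least common multiple of the vertex labels is the
    degree of j, reached at a vertex that chooses e_j in every summand
    containing it. *)
Lemma divides_label S b : forest S -> spanning S ->
  divides (cell_label (mcell S)) b <-> forall j, (degree S j <= mpoly.fun_of_multinom b j)%N.
Proof.
move=> fS sS; rewrite divides_biglcm; last first.
  apply: (@sub_finite_set _ _ (range (fun g : {ffun 'I_m -> 'I_n} => pt R g))).
    move=> v /(vertices_mcell _ fS sS)[g [_ ->]]; exists [ffun i => g i] => //.
    by rewrite /pt; congr colsum; apply/matrixP => i j; rewrite !mxE ffunE.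
  by apply: finite_image; exact: finite_finset.
split=> [h j|h v /(vertices_mcell _ fS sS)[g [gS ->]]].
  have /spanningP[g0 g0S] := sS.
  (* a vertex at which the coordinate j is as large as possible *)
  pose g i := if (i, j) \in S then j else g0 i.
  have gS i : (i, g i) \in S by rewrite /g; case: ifP.
  have /h/mpoly.mnm_lepP/(_ j) : vertices (mcell S) (pt R g).
    by apply/(vertices_mcell _ fS sS); exists g.
  rewrite mpoly.mnmE pt_coord natrK; apply: leq_trans.
  apply: subset_leq_card; apply/fintype.subsetP => i; rewrite !inE /g => ->.
  exact: eqxx.
apply/mpoly.mnm_lepP => j; rewrite mpoly.mnmE pt_coord natrK.
apply: leq_trans (h j); apply: subset_leq_card; apply/fintype.subsetP => i.
by rewrite !inE => /eqP <-.
Qed.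

End Labels.

Section FineCells.
Local Open Scope classical_set_scope.
Variables (R : realType) (m n : nat).
Local Notation V := 'rV[R]_n.

Lemma mcell1 (T : {set 'I_1 * 'I_n}) :
  @mcell R 1 n T = conv [set delta_mx 0 j | j in [set j | (ord0, j) \in T]].
Proof.
rewrite -mcell_minkowski; apply/seteqP; split=> [x [p [pT ->]]|x xT].
  by rewrite big_ord1.
exists (fun=> x); split; last by rewrite big_ord1.
by move=> i; rewrite ord1.
Qed.

(** Faces of standard simplices are standard simplices, and the summands being
    affinely independent means that the graph has no circulation: the rows of a
    circulation are directions of the summands with sum zero. *)
Lemma fine_cell (P : 'I_m -> set V) (X : set (set V)) :
  (forall i, standard_simplex (P i)) -> fine_mixed_subdivision P X ->
  forall s, X s -> exists S : {set 'I_m * 'I_n},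
    [/\ spanning S, @forest R m n S & s = @mcell R m n S].
Proof.
move=> hP [_ hX] s /hX[B [hB indep ->]].
have /choice[T hT] : forall i, exists T : {set 'I_1 * 'I_n},
    spanning T /\ B i = @mcell R 1 n T.
  move=> i; have [S [S0 PS]] := hP i; have [_ fB] := hB i.
  pose S1 : {set 'I_1 * 'I_n} := finset (fun e => e.2 \in S).
  have PS1 : P i = @mcell R 1 n S1.
    rewrite PS mcell1; congr conv; congr image.
    by apply/seteqP; split=> j /=; rewrite inE.
  have sS1 : spanning S1.
    have /finset.set0Pn[j jS] := S0.
    by apply/spanningP; exists (fun=> j) => k; rewrite inE.
  rewrite PS1 in fB; have [T1 [_ sT1 BT1]] := face_mcell sS1 fB.
  by exists T1.
pose S : {set 'I_m * 'I_n} := finset (fun e => (ord0, e.2) \in T e.1).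
exists S; split.
- apply/forallP => i; have [/forallP/(_ ord0)/existsP[j jT] _] := hT i.
  by apply/existsP; exists j; rewrite inE.
- move=> w wS wr wc.
  have rw0 : forall i, row i w = 0.
    apply: indep => [i|]; last first.
      rewrite -[RHS]wc; apply/rowP => j; rewrite mxE summxE.
      by apply: eq_bigr => i _; rewrite mxE.
    have [sT ->] := hT i; apply/direction_mcell => //.
    exists (row i w); split.
    + move=> [k j] /=; rewrite ord1 => kT; rewrite mxE; apply: (wS (i, j)).
      by rewrite inE.
    + by move=> k; rewrite -[RHS](wr i); apply: eq_bigr => j _; rewrite mxE.
    + by apply/rowP => j; rewrite !mxE big_ord1 mxE.
  by apply/row_matrixP => i; rewrite rw0 row0.
- rewrite -mcell_minkowski; congr minkowski_sum; apply/funext => i.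
  have [_ ->] := hT i; rewrite mcell1; congr conv; congr image.
  by apply/seteqP; split=> j /=; rewrite inE.
Qed.

End FineCells.

(** * Forests have leaves *)

Section Leaf.
Variables (R : realType) (m n : nat).
Local Notation E := ('I_m * 'I_n)%type.
Local Notation W := 'M[R]_(m, n).
Implicit Types (S T : {set E}) (e f : E).

(** The facets of the cell of T are the cells of T minus a removable edge, see
    [facet_mcell]. *)
Definition removable T e := (e \in T) && spanning (T :\ e).

Lemma spanning_sub S T : T \subset S -> spanning T -> spanning S.
Proof.
move=> /fintype.subsetP TS /spanningP[g gT]; apply/spanningP; exists g => i.
exact: TS.
Qed.

Lemma removableP T e : spanning T ->
  reflect (e \in T /\ exists2 j, j != e.2 & (e.1, j) \in T) (removable T e).
Proof.
move=> sT; apply: (iffP andP) => -[eT].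
  move=> /forallP/(_ e.1)/existsP[j]; rewrite !inE => /andP[je jT]; split=> //.
  by exists j => //; apply: contra je => /eqP ->; rewrite -surjective_pairing.
case=> j je jT; split=> //; have /spanningP[g gT] := sT.
apply/spanningP; exists (fun i => if i == e.1 then j else g i) => i.
rewrite in_setD1; have [->|ie] := eqVneq i e.1.
  by rewrite jT andbT; apply: contra je => /eqP <-.
by rewrite gT andbT; apply: contra ie => /eqP <-.
Qed.

Lemma card_fiber_ge2 (I J : finType) (A : {set I}) (h : I -> J) :
  (forall x, x \in A -> exists2 y, y \in A & y != x /\ h y = h x) ->
  (2 * #|h @: A| <= #|A|)%N.
Proof.
move=> hA; rewrite -[#|A|]sum1_card (partition_big h (mem (h @: A))) /=; last first.
  by move=> x xA; exact: imset_f.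
rewrite mulnC -sum_nat_const; apply: leq_sum => _ /imsetP[x xA ->].
rewrite sum1dep_card; have [y yA [yx yh]] := hA x xA.
by apply/card_gt1P; exists y, x; rewrite !inE yA xA yh eqxx yx.
Qed.

(** Let B be the set of edges in rows with at least two edges.  If no column had
    exactly one edge of B, then B would have at least twice as many edges as
    rows, and as columns.  The conditions that row and column sums vanish are
    dependent (both families have the same total), so they are fewer than the
    edges, and B would carry a nonzero circulation. *)
Lemma leaf_exists S : forest R S -> spanning S -> (exists e, removable S e) ->
  exists e, removable S e /\
    forall i, i != e.1 -> ~~ removable S (i, e.2).
Proof.
move=> fS sS [e0 e0S]; apply: contrapT => noleaf.
pose B : {set E} := finset (removable S).
have BS e : e \in B -> e \in S by rewrite inE => /andP[].
have rowB e : e \in B -> exists2 f, f \in B & f != e /\ f.1 = e.1.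
  rewrite inE => /(removableP _ sS)[eS [j je jS]]; exists (e.1, j).
    rewrite inE; apply/(removableP _ sS); split=> //=.
    by exists e.2; [rewrite eq_sym | rewrite -surjective_pairing].
  by split=> //; apply: contra je => /eqP <-.
have colB e : e \in B -> exists2 f, f \in B & f != e /\ f.2 = e.2.
  rewrite inE => eS; apply: contrapT => nf; apply: noleaf; exists e; split=> //.
  move=> i ie; apply/negP => iS; apply: nf; exists (i, e.2); first by rewrite inE.
  by split=> //; apply: contra ie => /eqP <-.
pose Nr := [set e.1 | e in B]; pose Nc := [set e.2 | e in B].
have r2 : (2 * #|Nr| <= #|B|)%N by exact: card_fiber_ge2.
have c2 : (2 * #|Nc| <= #|B|)%N by exact: card_fiber_ge2.
have e0B : e0 \in B by rewrite inE.
have c0 : e0.2 \in Nc by apply: imset_f.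
(* The column of e0 is left out: its condition follows from the others. *)
pose Nc' := Nc :\ e0.2.
have Nc'E : #|Nc| = #|Nc'|.+1 by rewrite (cardsD1 e0.2) c0.
pose P : finType := {e : E | e \in B}.
pose Q : finType := ({i | i \in Nr} + {j | j \in Nc'})%type.
pose M (p : P) (q : Q) : R :=
  match q with
  | inl i => ((val p).1 == val i)%:R | inr j => ((val p).2 == val j)%:R end.
have QP : (#|Q| < #|P|)%N.
  have cardE (I : finType) (A : {set I}) : #|{: {i | i \in A}}| = #|A|.
    by rewrite card_sig; apply: eq_card.
  rewrite /Q /P card_sum !cardE; move: r2 c2; rewrite Nc'E.
  by move: #|Nr| #|Nc'| #|B| => a b c; lia.
have [u [[p0 up0] hu]] := nonzero_of_underdetermined M QP.
pose w : W := \matrix_(i, j) if insub (i, j) is Some p then u p else 0.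
have wE p : w (val p).1 (val p).2 = u p.
  by rewrite mxE -surjective_pairing valK.
have wB e : e \notin B -> w e.1 e.2 = 0.
  by move=> eB; rewrite mxE -surjective_pairing insubF //; exact: negbTE.
have full (G : E -> R) : \sum_p u p * G (val p) = \sum_i \sum_j w i j * G (i, j).
  under eq_bigr do rewrite -wE.
  rewrite -(big_sub (mem B) (fun e => w e.1 e.2 * G e)) big_mkcond /=.
  rewrite -(sum_pair (fun e => w e.1 e.2 * G e)); apply: eq_bigr => e _.
  by case: ifPn => // /wB ->; rewrite mul0r.
have rows i : \sum_j w i j = 0.
  have [iN|iN] := boolP (i \in Nr); last first.
    apply: big1 => j _; apply: (wB (i, j)); apply: contra iN => ijB.
    by apply/imsetP; exists (i, j).
  have := hu (inl (Sub i iN)); rewrite (full (fun e => (e.1 == i)%:R)) /= => h.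
  rewrite -[RHS]h (bigD1 i) //= [X in _ + X]big1 ?addr0 => [|k ki].
    by apply: eq_bigr => j _; rewrite eqxx mulr1.
  by apply: big1 => j _; rewrite (negbTE ki) mulr0.
have cols' j : j != e0.2 -> \sum_i w i j = 0.
  move=> je; have [jN|jN] := boolP (j \in Nc'); last first.
    apply: big1 => i _; apply: (wB (i, j)); apply: contra jN => ijB.
    by rewrite !inE je; apply/imsetP; exists (i, j).
  have := hu (inr (Sub j jN)); rewrite (full (fun e => (e.2 == j)%:R)) /= => h.
  rewrite -[RHS]h exchange_big (bigD1 j) //= [X in _ + X]big1 ?addr0 => [|k kj].
    by apply: eq_bigr => i _; rewrite eqxx mulr1.
  by apply: big1 => i _; rewrite (negbTE kj) mulr0.
have cols j : \sum_i w i j = 0.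
  have [->|/cols'//] := eqVneq j e0.2.
  have : \sum_i \sum_j w i j = 0 by apply: big1 => i _; exact: rows.
  rewrite exchange_big (bigD1 e0.2) //= [X in _ + X]big1 ?addr0 => [-> //|k ke].
  exact: cols'.
have /(congr1 (fun w : W => w (val p0).1 (val p0).2)) : w = 0.
  apply: fS => // [e eS|]; last by apply/rowP => j; rewrite !mxE.
  by apply: wB; apply: contra eS; exact: BS.
by rewrite wE mxE => u0; rewrite u0 eqxx in up0.
Qed.

End Leaf.

(** * Acyclicity of the degree-bounded faces of one cell *)

Section LocalExact.
Variables (R : realType) (K : fieldType) (m n : nat).
Local Notation E := ('I_m * 'I_n)%type.
Local Notation W := 'M[R]_(m, n).
Implicit Types (S T : {set E}) (e f p : E) (w : W).
Variables (eps : {set E} -> {set E} -> K) (S0 : {set E}) (b : 'I_n -> nat).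

Hypothesis eps_sqr : forall T e, T \subset S0 -> removable T e ->
  eps T (T :\ e) * eps T (T :\ e) = 1.
Hypothesis eps_diamond : forall T e f, T \subset S0 -> e != f ->
  e \in T -> f \in T -> spanning (T :\ e :\ f) ->
  eps T (T :\ e) * eps (T :\ e) (T :\ e :\ f) +
  eps T (T :\ f) * eps (T :\ f) (T :\ e :\ f) = 0.
Hypothesis eps_edge : forall T, T \subset S0 -> spanning T -> #|T| = m.+1 ->
  \sum_(e | removable T e) eps T (T :\ e) = 0.

(** The coboundary of the augmented complex of spanning subgraphs; c0 is the value
    of the cochain at the empty face.  Subgraphs with m edges are the vertices. *)
Definition graph_cobd (c : {set E} -> K) (c0 : K) T : K :=
  (if #|T| == m then c0 else 0) +
  \sum_(e | removable T e) eps T (T :\ e) * c (T :\ e).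

(** The faces of the cell of S whose label divides the monomial with
    exponents b, see [divides_label]. *)
Definition bounded S T := [/\ T \subset S, spanning T & forall j, (degree T j <= b j)%N].

(** The cell of S contains a point in the orthant x_j <= b_j. *)
Definition feasible S := exists w, [/\ forall i j, 0 <= w i j, supported w S,
  forall i, \sum_j w i j = 1 & forall j, \sum_i w i j <= (b j)%:R].

Lemma bounded_mono S S' T : S' \subset S -> bounded S' T -> bounded S T.
Proof. by move=> SS' [TS' sT dT]; split=> //; exact: fintype.subset_trans SS'. Qed.

Lemma bounded_down S T T' : T' \subset T -> spanning T' -> bounded S T -> bounded S T'.
Proof.
move=> T'T sT' [TS sT dT]; split=> // [|j]; first exact: fintype.subset_trans TS.
exact: leq_trans (degree_mono j T'T) (dT j).
Qed.

Lemma graph_cobdB c c' c0 c0' T :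
  graph_cobd (fun T => c T - c' T) (c0 - c0') T = graph_cobd c c0 T - graph_cobd c' c0' T.
Proof.
rewrite /graph_cobd; under eq_bigr do rewrite mulrBr.
by rewrite sumrB; case: ifP => _; ring.
Qed.

(** Terms are cancelled in pairs, and not by halving, since K may have
    characteristic two. *)
Lemma antisym_sum (I : finType) (Q : rel I) (G : I -> I -> K) :
  symmetric Q -> irreflexive Q ->
  (forall i j, Q i j -> G i j + G j i = 0) -> \sum_i \sum_(j | Q i j) G i j = 0.
Proof.
move=> Qs Qi hG.
pose lt (i j : I) := (enum_rank i < enum_rank j)%N.
have split1 i : \sum_(j | Q i j) G i j =
    \sum_(j | Q i j && lt i j) G i j + \sum_(j | Q i j && lt j i) G i j.
  rewrite (bigID (lt i)) /=; congr (_ + _); apply: eq_bigl => j.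
  have [Qij|//] := boolP (Q i j); rewrite /= /lt -leqNgt leq_eqVlt.
  case: eqP => // /val_inj/enum_rank_inj ji.
  by rewrite ji Qi in Qij.
under eq_bigr do rewrite split1.
rewrite big_split /= [X in _ + X](exchange_big_dep xpredT) //= -big_split big1 //=.
move=> i _; rewrite [X in _ + X](eq_bigl (fun j => Q i j && lt i j)) => [|j].
  by rewrite -big_split big1 // => j /andP[Qij _]; exact: hG.
by rewrite Qs.
Qed.

Lemma removable_card T e : removable T e -> #|T :\ e| = #|T|.-1.
Proof. by move=> /andP[eT _]; rewrite (cardsD1 e T) eT. Qed.

(** Removing two edges in either order gives opposite signs. *)
Lemma graph_cobd2 c c0 T : T \subset S0 -> spanning T ->
  graph_cobd (graph_cobd c c0) 0 T = 0.
Proof.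
move=> TS sT; rewrite /graph_cobd; have -> : (if #|T| == m then 0 else 0) = 0 :> K.
  by case: ifP.
rewrite add0r; under eq_bigr do rewrite mulrDr.
rewrite big_split /= [X in X + _](_ : _ = 0) ?add0r.
  under eq_bigr do rewrite mulr_sumr.
  rewrite big_mkcond /=.
  pose Q e f := [&& e \in T, f \in T, e != f & spanning (T :\ e :\ f)].
  rewrite (eq_bigr (fun e => \sum_(f | Q e f) eps T (T :\ e) *
    (eps (T :\ e) (T :\ e :\ f) * c (T :\ e :\ f)))) => [|e _].
    apply: antisym_sum => [e f|e|e f /and4P[eT fT ef sTef]].
    - rewrite /Q eq_sym !finset.setDDl [in RHS]finset.setUC.
      by case: (e \in T); case: (f \in T).
    - by rewrite /Q eqxx !andbF.
    - rewrite !mulrA (_ : T :\ f :\ e = T :\ e :\ f); last first.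
        by rewrite !finset.setDDl finset.setUC.
      by rewrite -mulrDl eps_diamond ?mul0r.
  case: ifPn => [Te|Te].
    apply: eq_bigl => f; rewrite /Q /removable !inE.
    by case/andP: Te => -> _; rewrite [f == e]eq_sym; case: (f \in T); case: (e == f).
  rewrite big_pred0 // => f; apply/negP => /and4P[eT fT ef sTef].
  move/negP: Te; apply; rewrite /removable eT /=; apply: spanning_sub sTef.
  exact: subD1set.
have [Tm|Tm] := eqVneq #|T| m.+1.
  under eq_bigr => e Te do rewrite removable_card // Tm eqxx.
  by rewrite -mulr_suml eps_edge // mul0r.
apply: big1 => e Te; rewrite removable_card //; case: eqP => [Tm'|]; rewrite ?mulr0 //.
case/andP: Te => eT _; case/negP: Tm; apply/eqP.
have T0 : (0 < #|T|)%N by apply/card_gt0P; exists e.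
by rewrite -(prednK T0) Tm'.
Qed.

Section Homotopy.
Variables (S : {set E}) (p : E) (c : {set E} -> K).
Hypothesis SS0 : S \subset S0.
Hypothesis pS : p \in S.
Hypothesis degp : (degree S p.2 <= b p.2)%N.
Let S' := p |: [set e in S | e.1 != p.1].
Hypothesis cS' : forall T, bounded S' T -> c T = 0.
Hypothesis cT : forall T, bounded S T -> graph_cobd c 0 T = 0.

Let h T := if p \in T then 0 else eps (p |: T) T * c (p |: T).

Lemma bounded_add T : bounded S T -> bounded S (p |: T).
Proof.
move=> [TS sT dT]; have pTS : p |: T \subset S.
  by rewrite finset.subUset finset.sub1set pS.
split=> [//||j]; first exact: spanning_sub (finset.subsetUr _ _) sT.
have [->|jp] := eqVneq j p.2.
  exact: leq_trans (degree_mono _ pTS) degp.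
apply: leq_trans (dT j); apply: subset_leq_card; apply/fintype.subsetP => i.
rewrite !inE => /predU1P[ip|//]; by rewrite -ip eqxx in jp.
Qed.

Lemma bounded_star T : bounded S T -> (forall j, (p.1, j) \in T -> j = p.2) -> bounded S' T.
Proof.
move=> [TS sT dT] Tp; split=> //; apply/fintype.subsetP => e eT.
rewrite !inE (fintype.subsetP TS) //=; have [ep|_] := eqVneq e.1 p.1; rewrite /= ?orbT // orbF.
apply/eqP; rewrite [e]surjective_pairing [p]surjective_pairing -ep; congr pair.
by apply: Tp; rewrite -ep -surjective_pairing.
Qed.

(** If the edge p can be added to every bounded subgraph without exceeding the
    bounds, then adding p is a contracting homotopy, up to the subgraphs in which
    the row of p consists of p only, on which c vanishes by assumption. *)
Lemma homotopy T : bounded S T -> c T = graph_cobd h 0 T.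
Proof.
move=> lT; have [TS sT dT] := lT; have TS0 := fintype.subset_trans TS SS0.
rewrite /graph_cobd (_ : (if _ then 0 else 0) = 0) ?add0r; last by case: ifP.
have [pT|pT] := boolP (p \in T).
  have hf f : f != p -> eps T (T :\ f) * h (T :\ f) = 0.
    by move=> fp; rewrite /h !inE pT eq_sym fp mulr0.
  have [rp|rp] := boolP (removable T p).
    rewrite (bigD1 p) //= big1 ?addr0 => [|f /andP[_ /hf]//].
    by rewrite /h !inE eqxx /= finset.setD1K // mulrA eps_sqr ?mul1r.
  rewrite big1 => [|f rf].
    apply: cS'; apply: bounded_star => // j pjT; apply/eqP; apply: contraR rp => jp.
    by apply/(removableP _ sT); split=> //; exists j.
  by apply: hf; apply: contra rp => /eqP <-.
have lT' := bounded_add lT; have [T'S sT' dT'] := lT'.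
have T'S0 := fintype.subset_trans T'S SS0.
set T' := p |: T in lT' T'S sT' dT' T'S0 *.
have T'p : T' :\ p = T by rewrite finset.setU1K.
have rp : removable T' p by rewrite /removable finset.setU11 T'p.
have pp := eps_sqr T'S0 rp; rewrite T'p in pp.
have := cT lT'; rewrite /graph_cobd (_ : (if _ then 0 else 0) = 0) ?add0r; last by case: ifP.
rewrite (bigD1 p) //= T'p => /(congr1 (fun x => eps T' T * x)).
rewrite mulr0 mulrDr mulrA pp mul1r => /eqP; rewrite addr_eq0 => /eqP ->.
rewrite mulr_sumr -sumrN.
rewrite (bigID (removable T)) /= [X in _ + X]big1 ?addr0 => [|f]; last first.
  move=> /andP[/andP[rf fp] nf].
  have fT : f \in T.
    by case/andP: rf; rewrite in_setU1 (negbTE fp).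
  suff -> : c (T' :\ f) = 0 by rewrite !mulr0 oppr0.
  have [fT' sT'f] := andP rf.
  apply: cS'; apply: bounded_star; first exact: bounded_down (subD1set _ _) sT'f lT'.
  have fp1 : f.1 = p.1.
    apply/eqP; apply: contraR nf => fp1; apply/(removableP _ sT); split=> //.
    have [_ [j jf]] := removableP _ sT' rf.
    rewrite in_setU1 => /predU1P[fpE|jT]; last by exists j.
    by rewrite -fpE eqxx in fp1.
  move=> j; rewrite in_setD1 in_setU1 => /andP[jf /predU1P[<-//|jT]].
  exfalso; move/negP: nf; apply; apply/(removableP _ sT); split=> //; exists j.
    by apply: contra jf => /eqP ->; rewrite -fp1 -surjective_pairing.
  by rewrite fp1.
rewrite (eq_bigl (removable T)) => [|f]; last first.
  have [rf|] := boolP (removable T f); rewrite ?andbT ?andbF //.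
  have [fT sTf] := andP rf.
  have fp : f != p by apply: contra pT => /eqP <-.
  rewrite fp andbT /removable in_setU1 fT orbT /=.
  by apply: spanning_sub sTf; apply: finset.setSD; exact: finset.subsetUr.
apply: eq_bigr => f rf; have [fT sTf] := andP rf.
have fp : f != p by apply: contra pT => /eqP <-.
have pTf : p \notin T :\ f by rewrite in_setD1 negb_and pT orbT.
have TfE : p |: (T :\ f) = T' :\ f.
  by apply/setP => x; rewrite !inE; case: eqVneq => // ->; rewrite eq_sym fp.
have TfE' : T' :\ p :\ f = T :\ f by rewrite T'p.
rewrite /h (negbTE pTf) TfE.
have D : eps T' T * eps T (T :\ f) + eps T' (T' :\ f) * eps (T' :\ f) (T :\ f) = 0.
  have := @eps_diamond T' p f T'S0; rewrite TfE' T'p; apply=> //.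
  - by rewrite eq_sym.
  - by rewrite finset.setU11.
  - by rewrite in_setU1 fT orbT.
have B := eps_sqr TS0 rf.
rewrite !mulrA -mulNr; congr (_ * _).
have {}D : eps T' (T' :\ f) * eps (T' :\ f) (T :\ f) = - (eps T' T * eps T (T :\ f)).
  by apply/eqP; rewrite -addr_eq0 addrC D.
have C : eps T' (T' :\ f) * eps T' (T' :\ f) = 1.
  apply: eps_sqr => //; rewrite /removable in_setU1 fT orbT /=.
  by apply: spanning_sub sTf; apply: finset.setSD; exact: finset.subsetUr.
set x := eps T' T in D pp *; set y := eps T (T :\ f) in D B *.
set z := eps T' (T' :\ f) in D C *; set t := eps (T' :\ f) (T :\ f) in D *.
have -> : t = z * - (x * y) by rewrite -D mulrA C mul1r.
by transitivity (- (x * z) * (y * y)); [rewrite B mulr1 | ring].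
Qed.

End Homotopy.

Lemma feasible_spanning S : feasible S -> spanning S.
Proof.
move=> [w [w0 wS w1 _]]; apply: (@mcell_spanning R).
by exists (colsum w); exists w.
Qed.

(** By induction on the number of edges of S.  If every row has one edge, S is the
    only spanning subgraph.  Otherwise take a leaf p: an edge in
    a row with several edges, and the only such edge in its column.  If b allows the full degree
    of S at the column of p, first solve the problem on the smaller graph S'
    where the row of p is reduced to p, then subtract and apply [homotopy]; the
    point that witnesses feasibility is moved to e_j in that row.  If not, no
    bounded subgraph contains p: all other edges at this column are the only
    edges of their rows, so they belong to every spanning subgraph. *)
Lemma local_exact S : S \subset S0 -> forest R S -> feasible S ->
  forall c c0, (forall T, bounded S T -> graph_cobd c c0 T = 0) ->
  c0 = 0 /\ exists c' c0', forall T, bounded S T -> c T = graph_cobd c' c0' T.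
Proof.
have [N] := ubnP #|S|; elim: N S => // N IH S; rewrite ltnS => SN SS0 fS feas.
have sS := feasible_spanning feas.
move=> c c0 hc; have [w [w0 wS w1 wb]] := feas.
have [ex|nex] := pselect (exists e, removable S e); last first.
  have nr e : removable S e = false by apply/negP => re; apply: nex; exists e.
  have uniqS e f : e \in S -> f \in S -> e.1 = f.1 -> e = f.
    move=> eS fS' ef; rewrite [e]surjective_pairing [f]surjective_pairing ef.
    congr pair; apply/eqP/negPn/negP => ef2.
    have : removable S f.
      apply/(removableP _ sS); split=> //; exists e.2 => //.
      by rewrite -ef -surjective_pairing.
    by rewrite nr.
  have lowE T : bounded S T -> T = S.
    move=> [TS sT _]; apply/eqP; rewrite finset.eqEsubset TS; apply/fintype.subsetP => e eS.
    have /forallP/(_ e.1)/existsP[j jT] := sT.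
    by rewrite (uniqS e (e.1, j)) //; exact: (fintype.subsetP TS).
  have w1S e : e \in S -> w e.1 e.2 = 1.
    move=> eS; rewrite -(w1 e.1) (bigD1 e.2) //= big1 ?addr0 // => j je.
    apply: (wS (e.1, j)); apply: contra je => jS.
    by have /(congr1 snd)/= -> := uniqS (e.1, j) e jS eS erefl.
  have lS : bounded S S.
    split=> // j; rewrite -(ler_nat R); apply: le_trans (wb j).
    rewrite /degree -sum1_card natr_sum big_mkcond; apply: ler_sum => i _.
    by rewrite inE; case: ifPn => // /w1S/= ->.
  have cardS : #|S| == m.
    have /spanningP[g gS] := sS.
    rewrite -[X in _ == X]card_ord -(card_imset (mem 'I_m) (f := fun i => (i, g i))).
      apply/eqP; apply: eq_card => e; apply/idP/imsetP => [eS|[i _ ->]//].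
      by exists e.1 => //; apply: uniqS.
    by move=> i j [].
  have cobS c1 c2 : graph_cobd c1 c2 S = c2.
    by rewrite /graph_cobd cardS big_pred0 ?addr0.
  split; first by rewrite -(cobS c c0); exact: hc.
  by exists (fun=> 0), (c S) => T /lowE ->; rewrite cobS.
have [p [rp leaf]] := leaf_exists fS sS ex.
have [pS [k kp kS]] := removableP _ sS rp.
have [degp|degp] := leqP (degree S p.2) (b p.2).
  pose S' := p |: [set e in S | e.1 != p.1].
  have S'S : S' \subset S.
    by apply/fintype.subsetP => e; rewrite !inE => /predU1P[->//|/andP[]].
  have ltS' : (#|S'| < N)%N.
    apply: leq_trans SN; apply: proper_card; apply/fintype.properP; split=> //.
    by exists (p.1, k) => //; rewrite !inE eqxx andbF orbF; apply: contra kp => /eqP <-.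
  pose w' : W := \matrix_(i, j) if i == p.1 then (j == p.2)%:R else w i j.
  have w'0 i j : 0 <= w' i j by rewrite mxE; case: ifP => // _; rewrite ler0n.
  have w'S : supported w' S'.
    move=> [i j]; rewrite !inE mxE /= negb_or => /andP[ijp].
    have [ip _|ip] := eqVneq i p.1; last by rewrite andbT => /wS.
    case: eqP => // jp; move: ijp; rewrite ip jp -surjective_pairing eqxx //.
  have w'1 i : \sum_j w' i j = 1.
    under eq_bigr do rewrite mxE.
    case: eqP => [_|_]; last exact: w1.
    by rewrite (bigD1 p.2) //= eqxx big1 ?addr0 // => j /negbTE ->.
  have feas' : feasible S'.
    exists w'; split=> // j; have [->|jp] := eqVneq j p.2.
      apply: (@le_trans _ _ (degree S' p.2)%:R).
        have := @mcell_coord_le R m n S' (colsum w') p.2; rewrite mxE; apply.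
        by exists w'.
      by rewrite ler_nat; exact: leq_trans (degree_mono _ S'S) degp.
    apply: le_trans (wb j); apply: ler_sum => i _; rewrite mxE.
    by case: eqP => [->|//]; rewrite (negbTE jp).
  have [|c00 [c1 [c1' hc1]]] := IH S' ltS' (fintype.subset_trans S'S SS0)
      (forest_sub S'S fS) feas' c c0.
    by move=> T lT; apply: hc; exact: bounded_mono lT.
  split=> //; rewrite c00 in hc.
  (* the cochain corrected so as to vanish on the subgraphs of S' *)
  pose c2 T := c T - graph_cobd c1 c1' T.
  have c2S' T : bounded S' T -> c2 T = 0 by move=> lT; rewrite /c2 -hc1 ?subrr.
  have c2T T : bounded S T -> graph_cobd c2 0 T = 0.
    move=> lT; have [TS sT _] := lT; rewrite -(subrr 0) graph_cobdB hc //.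
    by rewrite graph_cobd2 ?subrr //; exact: fintype.subset_trans TS SS0.
  have H := homotopy SS0 pS degp c2S' c2T.
  set h := (fun T => if _ then _ else _) in H.
  exists (fun T => c1 T - - h T), (c1' - 0) => T lT.
  have -> : c T = c2 T + graph_cobd c1 c1' T by rewrite subrK.
  rewrite H // graph_cobdB addrC; congr (_ + _); rewrite /graph_cobd opprD -sumrN.
  by case: ifP => _; rewrite ?oppr0; congr (_ + _); apply: eq_bigr => e _;
    rewrite mulrN opprK.
(* No bounded subgraph uses p: its column is already full without it. *)
have deg1 i : i != p.1 -> (i, p.2) \in S -> forall j, (i, j) \in S -> j = p.2.
  move=> ip iS j ijS; apply/eqP/negPn/negP => jp; have := leaf i ip.
  by move/negP; apply; apply/(removableP _ sS); split=> //; exists j.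
pose S' := S :\ p.
have S'S : S' \subset S by exact: subD1set.
have ltS' : (#|S'| < N)%N.
  by apply: leq_trans SN; rewrite (cardsD1 p S) pS.
have lowS' T : bounded S T -> bounded S' T.
  move=> [TS sT dT]; split=> //; apply/fintype.subsetP => e eT.
  rewrite in_setD1 (fintype.subsetP TS) // andbT; apply/eqP => ep.
  move: degp; rewrite ltnNge => /negP; apply; apply: leq_trans (dT p.2).
  apply: subset_leq_card; apply/fintype.subsetP => i; rewrite !inE => iS.
  have [->|ip] := eqVneq i p.1; first by rewrite -surjective_pairing -ep.
  have /forallP/(_ i)/existsP[j ijT] := sT.
  by rewrite -(deg1 i ip iS j) //; exact: (fintype.subsetP TS).
have wp : w p.1 p.2 = 0.
  apply/eqP; rewrite eq_le w0 andbT -(lerD2r (b p.2)%:R) add0r.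
  apply: le_trans _ (wb p.2); rewrite (bigD1 p.1) //= lerD2l.
  apply: (@le_trans _ _ (degree S p.2).-1%:R).
    by rewrite ler_nat -ltnS prednK //; exact: leq_ltn_trans degp.
  rewrite /degree (cardsD1 p.1) inE -surjective_pairing pS /=.
  rewrite -sum1_card natr_sum big_mkcond [leRHS]big_mkcond; apply: ler_sum => i _.
  rewrite !inE; case: ifPn => [/andP[ip iS]|_]; last by case: ifP.
  rewrite ip -(w1 i) (bigD1 p.2) //= big1 ?addr0 // => j jp.
  apply: (wS (i, j)); apply: contra jp => ijS.
  by apply/eqP; exact: (deg1 i).
have feas' : feasible S'.
  exists w; split=> // e; rewrite in_setD1 negb_and negbK => /orP[/eqP ->//|].
  exact: wS.
have [|c00 [c1 [c1' hc1]]] := IH S' ltS' (fintype.subset_trans S'S SS0)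
    (forest_sub S'S fS) feas' c c0.
  by move=> T lT; apply: hc; exact: bounded_mono lT.
by split=> //; exists c1, c1' => T /lowS'; exact: hc1.
Qed.

End LocalExact.

(** * Generic flags of linear functionals *)

Section Flags.
Local Open Scope classical_set_scope.
Variables (R : realType) (n : nat).
Local Notation V := 'rV[R]_n.

Lemma poly_nonroot (p : {poly R}) : p != 0 -> exists x, p.[x] != 0.
Proof.
move=> p0; pose rs : seq R := [seq i%:R | i <- iota 0 (size p)].
have urs : uniq rs.
  by rewrite map_inj_uniq ?iota_uniq // => i j /eqP; rewrite eqr_nat => /eqP.
have : ~~ all (root p) rs.
  by apply/negP => ars; have := max_poly_roots p0 ars urs; rewrite size_map size_iota ltnn.
by case/allPn => x _ px; exists x.
Qed.

(** Vectors are polynomials of degree less than n, and pairing with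
    (1, x, x^2, ...) is evaluation at x; so take x outside the finitely many
    roots. *)
Lemma avoid_kernels (vs : seq V) : (forall v, v \in vs -> v != 0) ->
  exists f : V, forall v, v \in vs -> dot f v != 0.
Proof.
move=> vs0; pose q (v : V) : {poly R} := rVpoly v.
have [|x] := @poly_nonroot (\prod_(v <- vs) q v).
  rewrite prodf_seq_neq0; apply/allP => v /vs0 v0; apply: contra v0 => /eqP qv.
  by rewrite -[v]rVpolyK -/(q v) qv linear0.
rewrite horner_prod prodf_seq_neq0 => /allP qx.
exists (\row_i x ^+ i) => v /qx; congr (_ != 0).
rewrite (@horner_coef_wide _ n) ?size_poly //; apply: eq_bigr => i _.
by rewrite coef_rVpoly_ord mxE mulrC.
Qed.

Lemma cut_hyperplane (W : 'M[R]_n) (f : V) : exists W' : 'M[R]_n,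
  (forall v : V, (v <= W')%MS = (v <= W)%MS && (dot f v == 0)) /\
  (\rank W <= (\rank W').+1)%N /\
  ((exists v : V, (v <= W)%MS /\ dot f v != 0) -> (\rank W' < \rank W)%N).
Proof.
pose W' := (W :&: kermx f^T)%MS.
have W'E (v : V) : (v <= W')%MS = (v <= W)%MS && (dot f v == 0).
  rewrite sub_capmx; congr (_ && _); apply/sub_kermxP/eqP => [|h].
    move=> /rowP/(_ 0); rewrite [RHS]mxE => h; rewrite -[RHS]h mxE.
    by apply: eq_bigr => i _; rewrite mxE mulrC.
  apply/rowP => i; rewrite ord1 [RHS]mxE -[RHS]h mxE.
  by apply: eq_bigr => j _; rewrite mxE mulrC.
exists W'; split=> //; split.
  have := mxrank_sum_cap W (kermx f^T); rewrite -/W' mxrank_ker.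
  have := rank_leq_col (W + kermx f^T)%MS; have := rank_leq_row f.
  rewrite mxrank_tr; have := rank_leq_col f; lia.
move=> [v [vW fv]]; apply: rank_ltmx; rewrite ltmxE capmxSl /=.
apply/negP => /(submx_trans vW); rewrite W'E => /andP[_].
by rewrite (negbTE fv).
Qed.

(** Each new functional is chosen nonzero on what remains of every space D that
    is not yet exhausted, so that every dimension drops by one. *)
Lemma generic_flag (Ds : seq 'M[R]_n) (N : nat) : exists f : nat -> V,
  forall D, D \in Ds -> forall k, (k <= N)%N -> exists W : 'M[R]_n,
    (forall v : V, (v <= W)%MS <->
        (v <= D)%MS /\ forall l, (l < k)%N -> dot (f l) v = 0) /\
    \rank W = (\rank D - k)%N.
Proof.
elim: N => [|N [f IH]].
  exists (fun=> 0) => D _ k; rewrite leqn0 => /eqP ->; exists D; rewrite subn0.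
  by split=> // v; split=> [|[]].
have /choice[W hW] : forall D, exists W : 'M[R]_n, D \in Ds ->
    (forall v : V, (v <= W)%MS <->
        (v <= D)%MS /\ forall l, (l < N)%N -> dot (f l) v = 0) /\
    \rank W = (\rank D - N)%N.
  move=> D; have [DDs|DDs] := boolP (D \in Ds); last by exists 0.
  by have [W hW] := IH D DDs N (leqnn N); exists W.
have /choice[x hx] : forall D, exists x : V, W D != 0 -> (x <= W D)%MS /\ x != 0.
  move=> D; have [W0|/rowV0Pn[x xW x0]] := eqVneq (W D) 0; first by exists 0.
  by exists x.
have [|g hg] := @avoid_kernels [seq x D | D <- [seq D <- Ds | W D != 0]].
  by move=> v /mapP[D]; rewrite mem_filter => /andP[/hx[_ x0] _] ->.
exists (fun l => if l == N then g else f l) => D DDs k.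
rewrite leq_eqVlt => /orP[/eqP ->|]; last first.
  rewrite ltnS => kN; have [Wk [h1 h2]] := IH D DDs k kN; exists Wk; split=> // v.
  rewrite h1; split=> -[vD h]; split=> // l lk; have := h l lk;
    by rewrite ltn_eqF //; exact: leq_trans kN.
have [WD rW] := hW D DDs.
have [W' [W'E [rW1 rW2]]] := cut_hyperplane (W D) g.
exists W'; split=> [v|].
  rewrite W'E; split=> [/andP[/WD[vD h] /eqP gv]|[vD h]].
    split=> // l; rewrite ltnS leq_eqVlt; case: eqP => [->//|_ /= lN].
    exact: h.
  apply/andP; split; last by have := h N (ltnSn N); rewrite eqxx => ->.
  apply/WD; split=> // l lN; have := h l (ltnW lN).
  by rewrite ltn_eqF.
have [W0|W0] := eqVneq (W D) 0.
  have r0 : \rank (W D) = 0%N by rewrite W0 mxrank0.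
  have : (W' <= W D)%MS by apply/rV_subP => v; rewrite W'E => /andP[].
  by move/mxrankS; move: r0 rW; lia.
have [xW x0] := hx D W0.
have : (\rank W' < \rank (W D))%N.
  apply: rW2; exists (x D); split=> //; apply: hg; apply/mapP; exists D => //.
  by rewrite mem_filter W0.
by move: rW1 rW; lia.
Qed.

Lemma transversal_flag (cells : seq (set V)) : exists (f : nat -> V) (l : set V -> V),
  (forall s, s \in cells -> forall v, direction s v ->
     (forall k, (k < dim s)%N -> dot (f k) v = 0) -> v = 0) /\
  (forall s d, s \in cells -> dim s = d.+1 -> [/\ direction s (l s),
     forall k, (k < d)%N -> dot (f k) (l s) = 0 & dot (f d) (l s) = 1]).
Proof.
have /choice[D hD] : forall s, exists D : 'M[R]_n,
    (forall v, direction s v <-> (v <= D)%MS) /\ \rank D = dim s.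
  move=> s; have [k [M [Mf MA ->]]] := direction_matrix s.
  by exists <<M>>%MS; split=> [v|]; rewrite genmxE // (eqP Mf).
have [f hf] := generic_flag [seq D s | s <- cells] n.
have inj s v : s \in cells -> direction s v ->
    (forall k, (k < dim s)%N -> dot (f k) v = 0) -> v = 0.
  move=> sc /(hD s).1 vD h; have Dn : (dim s <= n)%N.
    by rewrite -(hD s).2 rank_leq_col.
  have [W [WE rW]] := hf (D s) (map_f D sc) _ Dn.
  have : (v <= W)%MS by apply/WE.
  by have /eqP := rW; rewrite (hD s).2 subnn mxrank_eq0 => /eqP ->; rewrite submx0 => /eqP.
exists f.
have /choice[l hl] : forall s, exists l, forall d, s \in cells -> dim s = d.+1 ->
   [/\ direction s l, forall k, (k < d)%N -> dot (f k) l = 0 & dot (f d) l = 1].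
  move=> s; have [sc|] := boolP (s \in cells); last by exists 0.
  case E : (dim s) => [|d]; first by exists 0.
  have dn : (d <= n)%N by rewrite ltnW // -E -(hD s).2 rank_leq_col.
  have [W [WE rW]] := hf (D s) (map_f D sc) _ dn.
  have : W != 0 by rewrite -mxrank_eq0 rW (hD s).2 E subSnn.
  case/rowV0Pn => x /WE[xD fx] x0.
  have xdir : direction s x by apply/(hD s).1.
  have fdx : dot (f d) x != 0.
    apply: contra x0 => /eqP fd0; apply/eqP/(inj s) => // k.
    by rewrite E ltnS leq_eqVlt => /orP[/eqP->//|/fx].
  exists ((dot (f d) x)^-1 *: x) => d' _ [<-]; split.
  - apply/(hD s).1; exact: scalemx_sub.
  - by move=> k kd; rewrite dotZr (fx _ kd) mulr0.
  - by rewrite dotZr mulVf.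
by exists l; split=> [s sc v|s d]; [exact: inj | exact: hl].
Qed.

End Flags.

(** * Supporting functionals and facets *)

Section Supporting.
Local Open Scope classical_set_scope.
Variables (R : realType) (m n : nat).
Local Notation V := 'rV[R]_n.
Local Notation E := ('I_m * 'I_n)%type.
Local Notation W := 'M[R]_(m, n).
Implicit Types (S T : {set E}) (w : W) (x v a : V) (g : 'I_m -> 'I_n).
Local Notation mcell := (@mcell R m n).
Local Notation forest := (@forest R m n).

Lemma mcell_pt_edges S T g : forest S -> T \subset S ->
  (forall i, (i, g i) \in S) -> mcell T (pt R g) -> forall i, (i, g i) \in T.
Proof.
move=> fS TS gS [w [w0 wT w1 wE]] i; apply: contraT => /wT/=.
rewrite -(_ : pt_weight R g = w); first by rewrite mxE eqxx => /eqP; rewrite oner_eq0.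
apply: (forest_inj fS) => //.
- exact: pt_weight_supported.
- by move=> e eS; apply: wT; apply: contra eS => /(fintype.subsetP TS).
- by move=> k; rewrite pt_weight_row w1.
Qed.

Lemma dot_direction_maximizers a A v : direction (maximizers a A) v -> dot a v = 0.
Proof.
move=> [k [c [x [y [h ->]]]]]; rewrite dot_sumr big1 // => i _.
have [[Ax xmax] [Ay ymax]] := h i; rewrite dotZr dotBr.
have -> : dot a (x i) = dot a (y i) by apply/eqP; rewrite eq_le xmax // ymax.
by rewrite subrr mulr0.
Qed.

(** Write w as w_e times the difference of two vertices, one on the facet and one
    off it across the edge e, plus a matrix supported on S minus e.  The
    functional a vanishes on directions of the facet and decreases when leaving
    it. *)
Lemma support_sign S e a w : forest S -> removable S e ->
  mcell (S :\ e) = maximizers a (mcell S) ->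
  supported w S -> (forall i, \sum_j w i j = 0) ->
  sgz (dot a (colsum w)) = - sgz (w e.1 e.2).
Proof.
move=> fS /andP[eS sT] Tmax wS wr; set T := S :\ e in sT Tmax.
have TS : T \subset S by exact: subD1set.
have /spanningP[g gT] := sT.
pose g' i := if i == e.1 then e.2 else g i.
have gS i : (i, g i) \in S by exact: (fintype.subsetP TS).
have g'S i : (i, g' i) \in S.
  by rewrite /g'; case: eqP => [->|//]; rewrite -surjective_pairing.
have gmax : maximizers a (mcell S) (pt R g) by rewrite -Tmax; exact: mcell_pt.
have Ng' : ~ mcell T (pt R g').
  move/(mcell_pt_edges fS TS g'S)/(_ e.1).
  by rewrite /g' eqxx -surjective_pairing !inE eqxx.
pose u := pt R g' - pt R g.
have au : dot a u < 0.
  rewrite /u dotBr subr_lt0 ltNge; apply/negP => le_gg'; apply: Ng'; rewrite Tmax.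
  split; first exact: mcell_pt.
  by move=> y /gmax.2 h; exact: le_trans le_gg'.
pose w' := w - w e.1 e.2 *: (pt_weight R g' - pt_weight R g).
have w'T : supported w' T.
  move=> [i j] ijT; rewrite !mxE /=.
  have gj : (j == g i) = false by apply/eqP => jg; rewrite jg gT in ijT.
  rewrite gj subr0; have [ijS|ijS] := boolP ((i, j) \in S); last first.
    rewrite (wS _ ijS) (_ : (j == g' i) = false) ?mulr0 ?subrr //.
    by apply/eqP => jg; rewrite jg g'S in ijS.
  move: ijT; rewrite !inE ijS andbT negbK => /eqP eE.
  have [-> ->] : i = e.1 /\ j = e.2 by rewrite -eE.
  by rewrite /g' !eqxx mulr1 subrr.
have w'r i : \sum_j w' i j = 0.
  under eq_bigr do rewrite !mxE.
  rewrite sumrB wr sub0r -mulr_sumr sumrB.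
  have := pt_weight_row R g' i; under eq_bigr do rewrite mxE; move=> ->.
  have := pt_weight_row R g i; under eq_bigr do rewrite mxE; move=> ->.
  by rewrite subrr mulr0 oppr0.
have /dot_direction_maximizers : direction (maximizers a (mcell S)) (colsum w').
  by rewrite -Tmax; apply/(direction_mcell _ sT); exists w'.
rewrite /w' colsumB colsumZ colsumB -/(pt R g') -/(pt R g) -/u dotBr dotZr.
move/eqP; rewrite subr_eq0 => /eqP ->.
by rewrite sgzM (ltr0_sgz au) mulrN1.
Qed.

(** By [dim_mcell], dropping the dimension by one means losing one edge. *)
Lemma facet_mcell S t : forest S -> spanning S ->
  (face t (mcell S) /\ dim (mcell S) = (dim t).+1) <->
  exists e, removable S e /\ t = mcell (S :\ e).
Proof.
move=> fS sS; split=> [[/(face_mcell sS)[T [TS sT ->]] dS]|[e [Se ->]]]; last first.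
  have [eS sT] := andP Se; have TS : S :\ e \subset S by exact: subD1set.
  split; first exact: mcell_face.
  apply/eqP; rewrite -(eqn_add2r m) addSn dim_mcell //.
  by rewrite (dim_mcell (forest_sub TS fS) sT) (cardsD1 e S) eS.
have dT := dim_mcell (forest_sub TS fS) sT; have := dim_mcell fS sS.
rewrite dS -(cardsID T S) (finset.setIidPr TS) -dT addSn -addn1 => /addnI/eqP.
move/eqP/esym/eqP/cards1P => [e SDT].
have eST : e \in S :\: T by rewrite SDT inE.
exists e; move: eST; rewrite !inE => /andP[eT eS].
have TE : T = S :\ e.
  by rewrite -SDT finset.setDDr finset.setDv finset.set0U; apply/esym/finset.setIidPr.
by rewrite /removable eS -TE.
Qed.

End Supporting.

(** * An incidence function *)

Section Incidence.
Local Open Scope classical_set_scope.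
Variables (R : realType) (m n : nat).
Local Notation V := 'rV[R]_n.
Local Notation E := ('I_m * 'I_n)%type.
Local Notation W := 'M[R]_(m, n).
Implicit Types (S T : {set E}) (w : W) (x v : V) (g : 'I_m -> 'I_n).
Local Notation mcell := (@mcell R m n).
Local Notation forest := (@forest R m n).

Variables (cells : seq (set V)) (f : nat -> V) (l : set V -> V)
  (a : set V -> set V -> V).
Hypothesis cells_face : forall s F, s \in cells -> face F s -> F \in cells.
Hypothesis flag_inj : forall s, s \in cells -> forall v, direction s v ->
  (forall k, (k < dim s)%N -> dot (f k) v = 0) -> v = 0.
Hypothesis flag_vec : forall s d, s \in cells -> dim s = d.+1 ->
  [/\ direction s (l s), forall k, (k < d)%N -> dot (f k) (l s) = 0
    & dot (f d) (l s) = 1].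
Hypothesis supporting : forall s t, face t s -> t = maximizers (a s t) s.

(** The vector l_s orients s: the sign tells whether t is an upper or a lower
    facet of s in the direction l_s. *)
Definition inc (s t : set V) : int :=
  if `[< face t s /\ dim s = (dim t).+1 >] then sgz (dot (a s t) (l s)) else 0.

Lemma inc_facet s t : inc s t != 0 -> face t s /\ dim s = (dim t).+1.
Proof. by rewrite /inc; case: asboolP => // _; rewrite eqxx. Qed.

Lemma inc_sign s t : inc s t \in [:: -1; 0; 1].
Proof. by rewrite /inc; case: asboolP => // _; case: sgzP. Qed.

(** Here w represents l_s.  Its coefficients at removable edges are nonzero: if
    one vanished, l_s would be a direction of a facet, on which the functionals
    that kill l_s are already injective. *)
Lemma cell_weight S : mcell S \in cells -> forest S -> spanning S ->
  exists w, [/\ supported w S, forall i, \sum_j w i j = 0,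
    forall d, dim (mcell S) = d.+1 ->
      (forall k, (k < d)%N -> dot (f k) (colsum w) = 0) /\ dot (f d) (colsum w) = 1
    & forall e, removable S e ->
      inc (mcell S) (mcell (S :\ e)) = - sgz (w e.1 e.2) /\ w e.1 e.2 != 0].
Proof.
move=> Sc fS sS; case E : (dim (mcell S)) => [|d].
  exists 0; split=> [e _|i|//|e Se]; rewrite ?mxE //.
    by apply: big1 => j _; rewrite mxE.
  have [_] : face (mcell (S :\ e)) (mcell S) /\ dim (mcell S) = (dim (mcell (S :\ e))).+1.
    by apply/facet_mcell => //; exists e.
  by rewrite E.
have [lS l0 l1] := flag_vec Sc E.
have [w [wS wr lE]] := (direction_mcell _ sS).1 lS.
exists w; split=> // [d' [<-]|e Se]; first by rewrite -lE.
have F : face (mcell (S :\ e)) (mcell S) /\ dim (mcell S) = (dim (mcell (S :\ e))).+1.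
  by apply/facet_mcell => //; exists e.
split.
  rewrite /inc asboolT // lE; apply: (support_sign fS Se) => //.
  by apply: supporting; case: F.
apply/eqP => we; have [Fe] := F; rewrite E => -[dT].
have [eS sT] := andP Se.
have : l (mcell S) = 0.
  apply: (flag_inj (cells_face Sc Fe)) => [|k]; last by rewrite -dT; exact: l0.
  rewrite lE; apply/(direction_mcell _ sT); exists w; split=> // e'.
  by rewrite !inE negb_and negbK => /orP[/eqP ->//|/wS].
by move=> lz; have := l1; rewrite lz dot0r => /eqP; rewrite eq_sym oner_eq0.
Qed.

Lemma inc_facetP S t : mcell S \in cells -> forest S -> spanning S ->
  inc (mcell S) t != 0 <-> face t (mcell S) /\ dim (mcell S) = (dim t).+1.
Proof.
move=> Sc fS sS; split; first exact: inc_facet.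
move=> /(facet_mcell _ fS sS)[e [Se ->]].
have [w [_ _ _ /(_ e Se)[-> we]]] := cell_weight Sc fS sS.
by rewrite oppr_eq0 sgz_eq0.
Qed.

Lemma removable_face S e : mcell S \in cells -> forest S -> removable S e ->
  [/\ mcell (S :\ e) \in cells, forest (S :\ e) & spanning (S :\ e)].
Proof.
move=> Sc fS /andP[eS sT]; have TS : S :\ e \subset S by exact: subD1set.
by split=> //; [apply: cells_face Sc _; exact: mcell_face | exact: forest_sub fS].
Qed.

(** Let U be S minus e and e', and w, u, v the matrices representing the
    vectors l of S, of S minus e and of S minus e'.  Subtracting multiples lam u
    and mu v from w clears the coefficients at e' and e, and leaves a direction
    of U killed by the functionals that are injective on U, hence zero.  Applying
    the next functional, which is 0 on w and 1 on u and v, gives lam + mu = 0,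
    which is the required relation between signs. *)
Lemma inc_diamond S e e' : mcell S \in cells -> forest S -> e != e' ->
  e \in S -> e' \in S -> spanning (S :\ e :\ e') ->
  inc (mcell S) (mcell (S :\ e)) * inc (mcell (S :\ e)) (mcell (S :\ e :\ e')) +
  inc (mcell S) (mcell (S :\ e')) * inc (mcell (S :\ e')) (mcell (S :\ e :\ e')) = 0.
Proof.
move=> Sc fS ee' eS e'S sU.
have UE : S :\ e :\ e' = S :\ e' :\ e by rewrite !finset.setDDl finset.setUC.
have Se : removable S e.
  by rewrite /removable eS; apply: spanning_sub sU; exact: subD1set.
have Se' : removable S e'.
  by rewrite /removable e'S; apply: spanning_sub sU; rewrite UE; exact: subD1set.
have SeU : removable (S :\ e) e' by rewrite /removable !inE eq_sym ee' e'S.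
have Se'U : removable (S :\ e') e by rewrite /removable !inE ee' eS -UE.
have sS : spanning S by apply: spanning_sub (andP Se).2; exact: subD1set.
have [ec ef es] := removable_face Sc fS Se.
have [e'c e'f e's] := removable_face Sc fS Se'.
have [Uc Uf _] := removable_face ec ef SeU.
have [w [wS wr wl wi]] := cell_weight Sc fS sS.
have [u [uS ur ul ui]] := cell_weight ec ef es.
have [v [vS vr vl vi]] := cell_weight e'c e'f e's.
have [ie we] := wi e Se; have [ie' we'] := wi e' Se'.
have [je ue'] := ui e' SeU; have := vi e Se'U; rewrite -UE => -[je' ve].
rewrite ie ie' je je' !mulrNN -!sgzM.
set d := dim (mcell (S :\ e :\ e')).
have d1 : dim (mcell (S :\ e)) = d.+1.
  by have [] : face (mcell (S :\ e :\ e')) (mcell (S :\ e)) /\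
    dim (mcell (S :\ e)) = d.+1 by apply/facet_mcell => //; exists e'.
have d1' : dim (mcell (S :\ e')) = d.+1.
  by have [] : face (mcell (S :\ e :\ e')) (mcell (S :\ e')) /\
    dim (mcell (S :\ e')) = d.+1 by apply/facet_mcell => //; exists e; rewrite -UE.
have d2 : dim (mcell S) = d.+2.
  by have [_] : face (mcell (S :\ e)) (mcell S) /\
    dim (mcell S) = (dim (mcell (S :\ e))).+1
    by [apply/facet_mcell => //; exists e]; rewrite d1.
have [w0 _] := wl _ d2; have [u0 u1] := ul _ d1; have [v0 v1] := vl _ d1'.
pose lam := w e'.1 e'.2 / u e'.1 e'.2; pose mu := w e.1 e.2 / v e.1 e.2.
pose r := w - (lam *: u + mu *: v).
have rU : supported r (S :\ e :\ e').
  move=> h; rewrite !mxE; have [->|he'] := eqVneq h e'.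
    by rewrite (vS e') ?inE ?eqxx // mulr0 addr0 divfK // subrr.
  have [->|he] := eqVneq h e.
    by rewrite (uS e) ?inE ?eqxx // mulr0 add0r divfK // subrr.
  rewrite !inE he he' /= => hS.
  by rewrite wS // uS ?inE ?he // vS ?inE ?he' // !mulr0 addr0 subrr.
have rr i : \sum_j r i j = 0.
  under eq_bigr do rewrite !mxE.
  by rewrite sumrB wr big_split /= -!mulr_sumr ur vr !mulr0 addr0 subrr.
have rE : colsum r = colsum w - (lam *: colsum u + mu *: colsum v).
  by rewrite colsumB colsumD !colsumZ.
have r0 : colsum r = 0.
  apply: (flag_inj Uc) => [|k kd]; first by apply/(direction_mcell _ sU); exists r.
  rewrite rE dotBr dotDr !dotZr w0 ?u0 ?v0 ?mulr0 ?addr0 ?subrr //.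
  exact: ltnW.
have := congr1 (dot (f d)) r0.
rewrite rE dotBr dotDr !dotZr w0 // u1 v1 !mulr1 dot0r sub0r => /eqP.
rewrite oppr_eq0 addr_eq0 => /eqP lm.
have -> : w e'.1 e'.2 * v e.1 e.2 = - (w e.1 e.2 * u e'.1 e'.2).
  have -> : w e'.1 e'.2 = lam * u e'.1 e'.2 by rewrite divfK.
  have -> : w e.1 e.2 = mu * v e.1 e.2 by rewrite divfK.
  by rewrite lm; ring.
by rewrite sgzN subrr.
Qed.

(** The only row with two edges has sum zero in w, so its two coefficients have
    opposite signs. *)
Lemma inc_edge S : mcell S \in cells -> forest S -> spanning S -> #|S| = m.+1 ->
  \sum_(e | removable S e) inc (mcell S) (mcell (S :\ e)) = 0.
Proof.
move=> Sc fS sS cS.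
have [[e0 Se0]|nex] := pselect (exists e, removable S e); last first.
  by rewrite big_pred0 // => e; apply/negP => Se; apply: nex; exists e.
have [w [wS wr _ wi]] := cell_weight Sc fS sS.
have [e0S sT] := andP Se0; have /spanningP[g gT] := sT.
have gS i : (i, g i) \in S by have := gT i; rewrite in_setD1 => /andP[].
have SE e : e \in S -> e != e0 -> e.2 = g e.1.
  move=> eS ee0; apply/eqP; apply: contraT => eg.
  have h2 : imset (fun i => (i, g i)) (mem 'I_m) \subset S :\ e0 :\ e.
    apply/fintype.subsetP => _ /imsetP[i _ ->]; rewrite in_setD1 gT andbT.
    by apply: contra eg => /eqP <-.
  have := subset_leq_card h2; rewrite card_imset; last by move=> i j [].
  rewrite card_ord; have := cS; rewrite (cardsD1 e0) e0S (cardsD1 e) in_setD1 ee0 eS.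
  rewrite !add1n => -[cm] h; have : (#|S :\ e0 :\ e|.+1 <= #|S :\ e0 :\ e|)%N.
    by rewrite cm.
  by rewrite ltnn.
pose e1 : E := (e0.1, g e0.1).
have e10 : e1 != e0 by have := gT e0.1; rewrite in_setD1 => /andP[].
have Se1 : removable S e1.
  apply/(removableP _ sS); split; first exact: gS.
  exists e0.2; last by rewrite /e1 /= -surjective_pairing.
  by apply: contra e10 => /eqP h; rewrite [e0]surjective_pairing h.
rewrite (bigD1 e0) //= (bigD1 e1) ?Se1 ?e10 //= big1 ?addr0; last first.
  move=> e /andP[/andP[Se ee0] ee1]; exfalso.
  have [eS [j je jS]] := removableP _ sS Se.
  have eg := SE e eS ee0.
  have [h|/(SE _ jS)/= jg] := eqVneq (e.1, j) e0; last by rewrite jg eg eqxx in je.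
  by move: ee1; rewrite /e1 -h /= -eg -surjective_pairing eqxx.
have [-> _] := wi _ Se0; have [-> _] := wi _ Se1.
rewrite -opprD; apply/eqP; rewrite oppr_eq0.
have -> : w e0.1 e0.2 = - w e1.1 e1.2.
  apply/eqP; rewrite -addr_eq0 -(wr e0.1) (bigD1 e0.2) //= (bigD1 (g e0.1)) /=.
    rewrite big1 ?addr0 // => j /andP[je0 jg]; apply: (wS (e0.1, j)).
    apply: contra jg => jS; apply/eqP; apply: (SE _ jS).
    by apply: contra je0 => /eqP <-.
  by apply: contra e10 => /eqP h; rewrite /e1 h -surjective_pairing.
by rewrite sgzN addNr.
Qed.

Section FaceClosedList.
Variable ys : seq (set V).
Hypothesis ys_uniq : uniq ys.
Hypothesis ys_cells : forall s, s \in ys -> s \in cells.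
Hypothesis ys_face : forall s F, s \in ys -> face F s -> F \in ys.

(** Distinct removable edges give distinct facets, by [mcell_inj]. *)
Lemma facets_sum (U : nmodType) S (G : set V -> U) : mcell S \in ys -> forest S ->
  spanning S -> (forall t, inc (mcell S) t = 0 -> G t = 0) ->
  \sum_(t <- ys) G t = \sum_(e | removable S e) G (mcell (S :\ e)).
Proof.
move=> Sy fS sS hG.
pose L := [seq mcell (S :\ e) | e <- enum (removable S)].
have LP t : reflect (exists e, removable S e /\ t = mcell (S :\ e)) (t \in L).
  apply: (iffP mapP) => [[e]|[e [Se ->]]].
    by rewrite mem_enum => Se ->; exists e.
  by exists e => //; rewrite mem_enum.
have uL : uniq L.
  rewrite map_inj_in_uniq ?enum_uniq // => e e'; rewrite !mem_enum => Se Se'.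
  have [eS es] := andP Se; have [e'S e's] := andP Se'.
  move/(mcell_inj fS (subD1set _ _) (subD1set _ _) es e's) => h.
  apply/eqP; apply: contraT => ee'; have : e \in S :\ e by rewrite h !inE ee' eS.
  by rewrite !inE eqxx.
rewrite -[RHS]big_enum /= -[RHS](big_map (fun e => mcell (S :\ e)) xpredT) -/L.
rewrite (bigID (mem L)) /= [X in _ + X]big1_seq ?addr0; last first.
  move=> t /andP[tL _]; apply: hG; apply/eqP; apply: contraNT tL => /inc_facet h.
  by apply/LP; apply/facet_mcell.
rewrite -big_filter; apply: perm_big; apply: uniq_perm => // [|t].
  exact: filter_uniq.
rewrite mem_filter; apply: andb_idr => /LP[e [Se ->]].
apply: ys_face Sy _; have [eS es] := andP Se.
by apply: mcell_face => //; exact: subD1set.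
Qed.

(** Only the two facets of the cell that contain a given face of codimension two
    contribute. *)
Lemma inc_inc S r : mcell S \in ys -> forest S -> spanning S ->
  \sum_(t <- ys) inc (mcell S) t * inc t r = 0.
Proof.
move=> Sy fS sS; have Sc := ys_cells Sy.
rewrite (facets_sum (G := fun t => inc (mcell S) t * inc t r) Sy fS sS); last first.
  by move=> t ->; rewrite mul0r.
have [h|/existsNP[e0 /not_implyP[Se0 /eqP nz]]] := pselect (forall e,
  removable S e -> inc (mcell (S :\ e)) r = 0).
  by apply: big1 => e /h ->; rewrite mulr0.
have [c0 f0 s0] := removable_face Sc fS Se0.
have [e1 [Se1 rE]] := (facet_mcell r f0 s0).1 (inc_facet nz).
have [e0S _] := andP Se0; have [] := andP Se1; rewrite in_setD1 => /andP[e10 e1S] s1.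
have Se1' : removable S e1.
  rewrite /removable e1S; apply: spanning_sub s1.
  by rewrite !finset.setDDl finset.setUC -finset.setDDl; exact: subD1set.
rewrite (bigD1 e0) //= (bigD1 e1) ?Se1' ?e10 //= big1 ?addr0; last first.
  move=> e /andP[/andP[Se ee0] ee1].
  have [->|nz'] := eqVneq (inc (mcell (S :\ e)) r) 0; first by rewrite mulr0.
  have [cc ff ss] := removable_face Sc fS Se.
  have [e' [Se' rE']] := (facet_mcell r ff ss).1 (inc_facet nz').
  have [eS _] := andP Se; have [_ s'] := andP Se'; exfalso.
  have sub e2 e3 : S :\ e2 :\ e3 \subset S.
    exact: fintype.subset_trans (subD1set _ _) (subD1set _ _).
  have /setP/(_ e) := mcell_inj fS (sub e0 e1) (sub e e') s1 s' (etrans (esym rE) rE').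
  by rewrite !inE eqxx ee0 ee1 eS andbF.
by rewrite rE; apply: inc_diamond => //; rewrite eq_sym.
Qed.

End FaceClosedList.

End Incidence.

(** * Acyclicity of the subcomplex below a monomial *)

Lemma sum_option (U : nmodType) (I : finType) (F : option I -> U) :
  \sum_x F x = F None + \sum_i F (Some i).
Proof.
rewrite (bigD1 None) //=; congr (_ + _).
rewrite (reindex_omap Some id) => [|[]//].
by apply: eq_bigl => i; rewrite /= eqxx.
Qed.

Section MixedComplex.
Local Open Scope classical_set_scope.
Variables (R : realType) (K : fieldType) (m n : nat).
Local Notation V := 'rV[R]_n.
Local Notation E := ('I_m * 'I_n)%type.
Implicit Types (S T : {set E}) (s : set V).
Local Notation mcell := (@mcell R m n).
Local Notation forest := (@forest R m n).

Variables (cells : seq (set V)) (P : set V) (b : mpoly.multinom n).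
Local Notation bd := (mpoly.fun_of_multinom b).

Hypothesis cells_mixed : forall s, s \in cells ->
  exists S, [/\ spanning S, forest S & s = mcell S].
Hypothesis cells_poly : forall s, s \in cells -> is_polytope s.
Hypothesis cells_face : forall s F, s \in cells -> face F s -> F \in cells.
Hypothesis cells_meet : forall s t, s \in cells -> t \in cells -> s `&` t !=set0 ->
  face (s `&` t) s /\ face (s `&` t) t.
Hypothesis convP : is_convex P.
Hypothesis coverP : forall x, P x <-> exists2 s, s \in cells & s x.

Variable ys : seq (set V).
Hypothesis ys_uniq : uniq ys.
Hypothesis ysP : forall s, s \in ys = (s \in cells) && divides (cell_label s) b.
Hypothesis ys_neq0 : exists s, s \in ys.

Definition orthant : set V := [set x | forall j, x 0 j <= (bd j)%:R].

Lemma orthant_closed : closed orthant.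
Proof.
have -> : orthant = \bigcap_j [set x : V | dot (delta_mx 0 j) x <= (bd j)%:R].
  have dE j (x : V) : dot (delta_mx 0 j) x = x 0 j.
    rewrite /dot (bigD1 j) //= big1 ?addr0 => [|k kj]; rewrite mxE eqxx.
      by rewrite eqxx mul1r.
    by rewrite (negbTE kj) mul0r.
  apply/seteqP; split=> [x h j _ /=|x h j]; first by rewrite dE.
  by have := h j I; rewrite /= dE.
by apply: closed_bigI => j _; exact: halfspace_le_closed.
Qed.

Lemma orthant_convex : is_convex orthant.
Proof.
move=> x y a hx hy a0 a1 j; rewrite !mxE; have := hx j; have := hy j.
by nra.
Qed.

Lemma ys_label S : mcell S \in cells -> forest S -> spanning S ->
  mcell S \in ys = [forall j, (degree S j <= bd j)%N].
Proof.
move=> Sc fS sS; rewrite ysP Sc; apply/idP/forallP => [/(divides_label _ fS sS)//|h].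
exact/(divides_label _ fS sS).
Qed.

Lemma ys_cells s : s \in ys -> s \in cells.
Proof. by rewrite ysP => /andP[]. Qed.

Lemma ys_face s F : s \in ys -> face F s -> F \in ys.
Proof.
move=> sy Fs; have sc := ys_cells sy; have Fc := cells_face sc Fs.
have [S [sS fS sE]] := cells_mixed sc; rewrite sE in sy sc Fs.
have [T [TS sT FE]] := face_mcell sS Fs; rewrite FE in Fc *.
rewrite ys_label //; last exact: forest_sub fS.
move: sy; rewrite ys_label // => /forallP h; apply/forallP => j.
exact: leq_trans (degree_mono j TS) (h j).
Qed.

Lemma ys_orthant s : s \in ys -> s `<=` orthant.
Proof.
move=> sy; have sc := ys_cells sy; have [S [sS fS sE]] := cells_mixed sc.
rewrite sE in sy sc *; move: sy; rewrite ys_label // => /forallP h x xS j.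
by apply: le_trans (mcell_coord_le j xS) _; rewrite ler_nat.
Qed.

Lemma cells_neq0 s : s \in cells -> s !=set0.
Proof. by case/cells_mixed => S [sS _ ->]; exact: mcell_neq0. Qed.

(** Intersections of cells are faces, so they are cells or empty. *)
Lemma common_cell (t : seq (set V)) : t != [::] -> (forall s, s \in t -> s \in cells) ->
  (exists x, forall s, s \in t -> s x) ->
  exists2 s0, s0 \in cells & forall x, s0 x <-> forall s, s \in t -> s x.
Proof.
elim: t => // s t IH _ stc [x xst].
have sc : s \in cells by apply: stc; rewrite mem_head.
have [->|t0] := eqVneq t [::].
  exists s => // y; split=> [sy u|]; first by rewrite inE => /eqP ->.
  by apply; rewrite mem_head.
have [||s0 s0c s0E] := IH t0.
- by move=> u ut; apply: stc; rewrite inE ut orbT.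
- by exists x => u ut; apply: xst; rewrite inE ut orbT.
have ss0 : s `&` s0 !=set0.
  exists x; split; first by apply: xst; rewrite mem_head.
  by apply/s0E => u ut; apply: xst; rewrite inE ut orbT.
exists (s `&` s0); first exact: cells_face sc (cells_meet sc s0c ss0).1.
move=> y; split=> [[sy /s0E h] u|h]; first by rewrite inE => /predU1P[->//|/h].
split; first by apply: h; rewrite mem_head.
by apply/s0E => u ut; apply: h; rewrite inE ut orbT.
Qed.

Lemma subcell_face s t : s \in cells -> t \in cells -> s `<=` t -> face s t.
Proof.
move=> sc tc st; have sI : s `&` t = s by exact/setIidPl.
have := cells_meet sc tc; rewrite sI => /(_ (cells_neq0 sc)).
by case.
Qed.

Variables (f : nat -> V) (l : set V -> V) (a : set V -> set V -> V).
Hypothesis flag_inj : forall s, s \in cells -> forall v, direction s v ->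
  (forall k, (k < dim s)%N -> dot (f k) v = 0) -> v = 0.
Hypothesis flag_vec : forall s d, s \in cells -> dim s = d.+1 ->
  [/\ direction s (l s), forall k, (k < d)%N -> dot (f k) (l s) = 0
    & dot (f d) (l s) = 1].
Hypothesis supporting : forall s t, face t s -> t = maximizers (a s t) s.

Local Notation inc := (inc l a).
Local Notation N := (size ys).
Let J : finType := option 'I_N.
Let cell (j : 'I_N) : set V := nth set0 ys j.

Let cell_in j : cell j \in ys. Proof. exact: mem_nth. Qed.

Let sum_ys (U : nmodType) (F : set V -> U) : \sum_(s <- ys) F s = \sum_j F (cell j).
Proof. by rewrite (big_nth set0) big_mkord. Qed.

(** The incidence numbers of Y, with None standing for the empty face. *)
Definition aug_inc (y z : J) : K :=
  match y, z with
  | Some s, Some t => (inc (cell s) (cell t))%:~R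
  | Some s, None => (dim (cell s) == 0%N)%:R
  | None, _ => 0
  end.

Definition level (y : J) : nat := if y is Some s then (dim (cell s)).+1 else 0%N.

Lemma aug_inc_level y z : aug_inc y z != 0 -> level y = (level z).+1.
Proof.
case: y => [s|]; case: z => [t|] //=; rewrite ?eqxx //; last first.
  by have [->|] := eqVneq (dim (cell s)) 0%N; rewrite ?eqxx.
have [->|/inc_facet[_ ->]//] := eqVneq (inc (cell s) (cell t)) 0.
by rewrite mulr0z eqxx.
Qed.

Lemma dim_facet_sum S : mcell S \in ys -> forest S -> spanning S ->
  \sum_(t <- ys) inc (mcell S) t * (dim t == 0%N)%:R = 0.
Proof.
move=> Sy fS sS; have Sc := ys_cells Sy.
have [d1|d1] := eqVneq (dim (mcell S)) 1%N; last first.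
  apply: big1 => t _; have [->|/inc_facet[_ d]] := eqVneq (inc (mcell S) t) 0.
    by rewrite mul0r.
  by case: eqP => [t0|]; rewrite ?mulr0 //; move: d1; rewrite d t0.
rewrite (facets_sum (l := l) (a := a) ys_uniq ys_face
    (G := fun t => inc (mcell S) t * (dim t == 0%N)%:R) Sy fS sS); last first.
  by move=> t ->; rewrite mul0r.
have cS : #|S| = m.+1 by rewrite -(dim_mcell fS sS) d1.
rewrite -[RHS](inc_edge cells_face flag_inj flag_vec supporting Sc fS sS cS).
apply: eq_bigr => e Se; have [_] : face (mcell (S :\ e)) (mcell S) /\
    dim (mcell S) = (dim (mcell (S :\ e))).+1 by apply/facet_mcell => //; exists e.
by rewrite d1 => -[<-]; rewrite mulr1.
Qed.

Lemma aug_inc2 y z : \sum_x aug_inc y x * aug_inc x z = 0.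
Proof.
case: y => [s|]; last by rewrite big1 // => x _; rewrite mul0r.
rewrite sum_option mulr0 add0r.
have [S [sS fS sE]] := cells_mixed (ys_cells (cell_in s)).
have Sy := cell_in s; rewrite sE in Sy.
case: z => [r|] /=.
  rewrite -(sum_ys (fun t => (inc (cell s) t)%:~R * (inc t (cell r))%:~R)) sE.
  under eq_bigr do rewrite -intrM.
  by rewrite -(big_morph _ (@intrD K) (mulr0z 1)) (inc_inc cells_face flag_inj flag_vec supporting
    ys_uniq ys_cells ys_face).
rewrite -(sum_ys (fun t => (inc (cell s) t)%:~R * (dim t == 0%N)%:R)) sE.
under eq_bigr do rewrite -[_%:R]mulrz_nat -intrM.
rewrite -(big_morph _ (@intrD K) (mulr0z 1)) -[RHS](mulr0z 1); congr (_ *~ _).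
rewrite -[RHS](dim_facet_sum Sy fS sS); apply: eq_bigr => t _.
by case: (dim t == 0%N).
Qed.

(** The empty face is admissible when the cells of the list have a common point
    in the orthant, a nonempty face when it lies in all of them. *)
Definition adm (t : seq (set V)) (y : J) : Prop :=
  match y with
  | None => nerve cells P orthant t
  | Some j => forall s, s \in t -> s \in cells /\ cell j `<=` s
  end.

Lemma adm_sub u t y : subseq u t -> adm t y -> adm u y.
Proof.
case: y => [j|] ut; last exact: nerve_subseq.
by move=> h s /(mem_subseq ut)/h.
Qed.

Lemma adm_none t j : adm t (Some j) -> adm t None.
Proof.
move=> h; split=> [s /h[]//|].
have cj := ys_cells (cell_in j); have [x jx] := cells_neq0 cj.
exists x; split=> [||s /h[_]]; last exact.
- by apply/coverP; exists (cell j).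
- exact: ys_orthant (cell_in j) _ jx.
Qed.

Lemma adm_inc t y z : adm t y -> aug_inc y z != 0 -> adm t z.
Proof.
case: y => [s|] ; last by rewrite /= eqxx.
case: z => [r|] ts /=; last by move=> _; exact: adm_none ts.
have [->|/inc_facet[[u ->] _]] := eqVneq (inc (cell s) (cell r)) 0.
  by rewrite mulr0z eqxx.
by move=> _ q /ts[qc sq]; split=> // x [/sq].
Qed.

(** The row of the empty face is the nerve; in the row of a cell of Y, that cell
    can be prepended to every list. *)
Lemma adm_rows y : @row_exact _ J K adm y.
Proof.
case: y => [j|] k phi hphi; last first.
  have PC : P `&` orthant !=set0.
    have [s sy] := ys_neq0; have sc := ys_cells sy; have [x sx] := cells_neq0 sc.
    exists x; split; first by apply/coverP; exists s.
    exact: ys_orthant sy _ sx.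
  have cellP s : s \in cells -> is_convex s /\ compact s.
    by move=> /cells_poly p; split; [exact: polytope_convex | exact: polytope_compact].
  have cellI s t : s \in cells -> t \in cells -> s `&` t !=set0 -> s `&` t \in cells.
    by move=> sc tc st; exact: cells_face sc (cells_meet sc tc st).1.
  have [t Ct|psi hpsi] := convex_nerve_acyclic cellP cellI convP coverP
    orthant_closed orthant_convex PC (phi := fun t => if size t == k then phi t else 0).
    have [st|st] := eqVneq (size t) k.+1.
      rewrite -[RHS](hphi t Ct st); apply: delta_ext => u ut su.
      by move: su; rewrite st => -[->]; rewrite eqxx.
    transitivity (delta (fun _ => 0 : K) t); last first.
      by elim: (t) => //= x u ->; rewrite subr0.
    apply: delta_ext => u ut su; case: eqP => // uk.
    by move: st; rewrite -su uk eqxx.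
  by exists psi => t Ct st; rewrite -hpsi // st eqxx.
exists (fun u => phi (cell j :: u)) => t tj st; rewrite delta_cone hphi ?subr0 //=.
  move=> s; rewrite inE => /predU1P[->|/tj//].
  by split=> //; exact: ys_cells.
by rewrite st.
Qed.

Let value_at (c : J -> K) (s : set V) : K :=
  if insub (index s ys) is Some j then c (Some j) else 0.

Let value_cell c j : value_at c (cell j) = c (Some j).
Proof. by rewrite /value_at index_uniq // valK. Qed.

Let eps T T' : K := (inc (mcell T) (mcell T'))%:~R.

(** Inside one cell, the complex of faces is the complex of spanning
    subgraphs. *)
Lemma cobd_graph_cobd c j T : cell j = mcell T -> forest T -> spanning T ->
  cobd aug_inc c (Some j) = graph_cobd eps (fun T => value_at c (mcell T)) (c None) T.
Proof.
move=> jT fT sT; rewrite /cobd sum_option /= jT; congr (_ + _).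
  have -> : (#|T| == m) = (dim (mcell T) == 0%N).
    by rewrite -(dim_mcell fT sT) -[X in _ == X]add0n eqn_add2r.
  by case: (dim (mcell T) == 0%N); rewrite ?mul1r ?mul0r.
under eq_bigr do rewrite -value_cell.
rewrite -(sum_ys (fun t => (inc (mcell T) t)%:~R * value_at c t)).
rewrite (facets_sum (l := l) (a := a) ys_uniq ys_face
    (G := fun t => (inc (mcell T) t)%:~R * value_at c t) _ fT sT) //.
  by rewrite -jT.
by move=> t ->; rewrite mulr0z mul0r.
Qed.

(** For a list of cells with a common point in the orthant, the faces in question
    are those of the intersection of the cells, a cell S; in terms of graphs they
    are the bounded subgraphs of S, and the common point makes S feasible, so
    that [local_exact] applies.  If there is no common point in the orthant, no
    face is admissible. *)
Lemma adm_cols t : t != [::] -> column_exact aug_inc level adm t.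
Proof.
move=> t0 c k hc.
have [tN|tN] := pselect (adm t None); last first.
  by exists (fun=> 0) => -[j|] // /adm_none.
have [tc [x [Px Cx xt]]] := tN.
have [s0 s0c s0E] := common_cell t0 tc (ex_intro _ x xt).
have [S [sS fS sE]] := cells_mixed s0c; subst s0.
have subc T : T \subset S -> spanning T -> mcell T \in cells.
  by move=> TS sT; apply: cells_face s0c _; exact: mcell_face.
have admP j : adm t (Some j) <-> exists T, bounded bd S T /\ cell j = mcell T.
  split=> [tj|[T [[TS sT dT] jT]] s st]; last first.
    by split; [exact: tc | rewrite jT => y /(mcell_mono TS)/s0E; exact].
  have jy := cell_in j; have jc := ys_cells jy.
  have jS : face (cell j) (mcell S).
    by apply: subcell_face => // y jy'; apply/s0E => s /tj[_]; exact.
  have [T [TS sT jT]] := face_mcell sS jS; exists T; split=> //; split=> //.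
  rewrite jT in jy jc; move: jy; rewrite ys_label //; last exact: forest_sub fS.
  by move/forallP.
have lowj T : bounded bd S T -> exists j, cell j = mcell T.
  move=> [TS sT dT]; have Ty : mcell T \in ys.
    by rewrite ys_label ?subc //; [exact/forallP | exact: forest_sub fS].
  have iT : (index (mcell T) ys < N)%N by rewrite index_mem.
  by exists (Ordinal iT); rewrite /cell nth_index.
have feas : feasible R bd S.
  have /s0E [w [w0 wS w1 xE]] := xt; exists w; split=> // j.
  by have := Cx j; rewrite xE mxE.
have eps_sqr T e : T \subset S -> removable T e -> eps T (T :\ e) * eps T (T :\ e) = 1.
  move=> TS Te; have sT : spanning T.
    by apply: spanning_sub (andP Te).2; exact: subD1set.
  have fT := forest_sub TS fS.
  have : inc (mcell T) (mcell (T :\ e)) != 0.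
    apply/(inc_facetP cells_face flag_inj flag_vec supporting); rewrite ?subc //.
    by apply/facet_mcell => //; exists e.
  have := inc_sign l a (mcell T) (mcell (T :\ e)); rewrite /eps -intrM !inE.
  by case/or3P => /eqP ->.
have eps_diamond T e f' : T \subset S -> e != f' -> e \in T -> f' \in T ->
    spanning (T :\ e :\ f') ->
    eps T (T :\ e) * eps (T :\ e) (T :\ e :\ f') +
    eps T (T :\ f') * eps (T :\ f') (T :\ e :\ f') = 0.
  move=> TS ef eT fT sU; rewrite /eps -!intrM -intrD.
  rewrite (inc_diamond cells_face flag_inj flag_vec supporting) //.
    apply: subc => //; apply: spanning_sub sU.
    exact: fintype.subset_trans (subD1set _ _) (subD1set _ _).
  exact: forest_sub fS.
have eps_edge T : T \subset S -> spanning T -> #|T| = m.+1 ->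
    \sum_(e | removable T e) eps T (T :\ e) = 0.
  move=> TS sT cT; rewrite -(big_morph _ (@intrD K) (mulr0z 1)).
  rewrite (inc_edge cells_face flag_inj flag_vec supporting) ?subc //.
  exact: forest_sub fS.
(* Truncating to one level makes the cocycle condition hold at all levels. *)
pose c' y := if level y == k then c y else 0.
have hc' y : adm t y -> cobd aug_inc c' y = 0.
  move=> ty; have [ly|ly] := eqVneq (level y) k.+1.
    rewrite -[RHS](hc y ty ly); apply: eq_bigr => z _.
    have [->|/aug_inc_level lz] := eqVneq (aug_inc y z) 0; first by rewrite !mul0r.
    by rewrite /c'; move: lz; rewrite ly => -[->]; rewrite eqxx.
  apply: big1 => z _; have [->|/aug_inc_level lz] := eqVneq (aug_inc y z) 0.
    by rewrite mul0r.
  by rewrite /c'; case: eqP => [zk|]; rewrite ?mulr0 //; rewrite lz zk eqxx in ly.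
have [T lT|c'0 [d [d0 hd]]] := local_exact eps_sqr eps_diamond eps_edge
    (fintype.subxx S) fS feas (c := fun T => value_at c' (mcell T)) (c0 := c' None).
  have [j jT] := lowj T lT; have [TS sT _] := lT.
  rewrite -(cobd_graph_cobd c' jT) //; last exact: forest_sub fS.
  by apply: hc'; apply/admP; exists T.
have /choice[lab hlab] : forall s, exists T, (exists T', bounded bd S T' /\ s = mcell T') ->
    bounded bd S T /\ s = mcell T.
  move=> s; have [[T h]|h] := pselect (exists T', bounded bd S T' /\ s = mcell T').
    by exists T.
  by exists finset.set0 => /h.
have labE T : bounded bd S T -> lab (mcell T) = T.
  move=> lT; have [[TS sT _]] := hlab (mcell T) (ex_intro _ T (conj lT erefl)).
  have [TS' sT' _] := lT.
  by move=> h; apply: (mcell_inj fS) => //; exact: esym.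
pose bb (y : J) : K := if y is Some j then d (lab (cell j)) else d0.
exists bb => -[j|] ty ly; last first.
  rewrite /cobd big1 => [|z _]; last by rewrite mul0r.
  by have := c'0; rewrite /c' ly eqxx.
have [T [lT jT]] := (admP j).1 ty; have [TS sT _] := lT.
rewrite (cobd_graph_cobd bb jT) //; last exact: forest_sub fS.
have -> : c (Some j) = value_at c' (mcell T) by rewrite -jT value_cell /c' ly eqxx.
rewrite hd // /graph_cobd; congr (_ + _); apply: eq_bigr => e Te; congr (_ * _).
have lTe : bounded bd S (T :\ e).
  by apply: bounded_down lT; [exact: subD1set | exact: (andP Te).2].
by have [i iT] := lowj _ lTe; rewrite -iT value_cell /bb iT labE.
Qed.

Lemma aug_exact (c : J -> K) : (forall z, \sum_y aug_inc y z * c y = 0) ->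
  exists b', forall z, c z = \sum_y aug_inc y z * b' y.
Proof.
apply: transpose_exact; first exact: aug_inc2.
apply: (ungraded_exact (lev := level)); first exact: aug_inc_level.
move=> c' k hc'; have [|b' hb'] := double_complex_exact aug_inc2 aug_inc_level adm_sub adm_inc
  adm_cols adm_rows (c := c') (l := k).
  by move=> y _; exact: hc'.
exists b' => y ly; apply: hb' => //; have [s sy] := ys_neq0.
have iy : (index s ys < N)%N by rewrite index_mem.
by case: y {ly} => [j|]; [|apply: (@adm_none [::] (Ordinal iy))] => u; rewrite in_nil.
Qed.

Let Y : set (set V) := [set` ys].

Let sum_Y (U : nmodType) (F : set V -> U) : \sum_(s \in Y) F s = \sum_(s <- ys) F s.
Proof. by rewrite -fsbig_seq. Qed.

Lemma inc_incidence : incidence_function Y inc.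
Proof.
split=> [s t _ _|s t sy ty|s r sy ry|s sy d1]; first exact: inc_sign.
- have [S [sS fS sE]] := cells_mixed (ys_cells sy); rewrite sE in sy *.
  exact: (inc_facetP cells_face flag_inj flag_vec supporting t (ys_cells sy) fS sS).
- have [S [sS fS sE]] := cells_mixed (ys_cells sy); rewrite sE in sy *.
  by rewrite sum_Y (inc_inc cells_face flag_inj flag_vec supporting
    ys_uniq ys_cells ys_face).
- have [S [sS fS sE]] := cells_mixed (ys_cells sy); rewrite sE in sy d1 *.
  rewrite sum_Y -[RHS](dim_facet_sum sy fS sS); apply: eq_bigr => t _.
  have [->|/inc_facet[_]] := eqVneq (inc (mcell S) t) 0; first by rewrite mul0r.
  by rewrite d1 => -[<-]; rewrite mulr1.
Qed.

Lemma below_acyclic : acyclic K Y.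
Proof.
split; first by have [s sy] := ys_neq0; exists s.
exists inc; split; first exact: inc_incidence.
move=> i c [cY hc].
pose c1 (y : J) : K := if y is Some j then c (cell j) else 0.
have [z|b1 hb1] := aug_exact (c := c1).
  rewrite sum_option mulr0 add0r; case: z => [t|] /=; last first.
    have [i0|i0] := eqVneq i 0%N; last first.
      apply: big1 => j _; have [->|/cY[_ dj]] := eqVneq (c (cell j)) 0.
        by rewrite mulr0.
      by rewrite dj (negbTE i0) mul0r.
    move: hc; rewrite i0 /= /augmentation sum_Y sum_ys => h; rewrite -[RHS]h.
    apply: eq_bigr => j _; have [->|/cY[_ dj]] := eqVneq (c (cell j)) 0.
      by rewrite mulr0.
    by rewrite dj i0 mul1r.
  have [i0|i0] := eqVneq i 0%N.
    apply: big1 => j _; have [->|/inc_facet[_ dj]] := eqVneq (inc (cell j) (cell t)) 0.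
      by rewrite mulr0z mul0r.
    have [->|/cY[_ dj']] := eqVneq (c (cell j)) 0; first by rewrite mulr0.
    by move: dj; rewrite dj' i0.
  move: hc; rewrite (negbTE i0) => /(_ (cell t) (cell_in t)).
  by rewrite /boundary sum_Y sum_ys.
exists (fun s => if (s \in ys) && (dim s == i.+1) then value_at b1 s else 0); split.
  by move=> s; case: ifP => [/andP[sy /eqP ds] _|]; rewrite ?eqxx.
move=> t ty; rewrite /boundary sum_Y sum_ys.
have it : (index t ys < N)%N by rewrite index_mem.
have tE : t = cell (Ordinal it) by rewrite /cell nth_index.
have [dt|dt] := eqVneq (dim t) i.
  have := hb1 (Some (Ordinal it)); rewrite sum_option mul0r add0r /= -tE => ->.
  apply: eq_bigr => j _; rewrite cell_in value_cell.
  have [->|/inc_facet[_ ->]] := eqVneq (inc (cell j) t) 0; first by rewrite mulr0z !mul0r.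
  by rewrite dt eqxx.
have [->|/cY[_ dt']] := eqVneq (c t) 0; last by rewrite dt' eqxx in dt.
rewrite big1 // => j _; rewrite cell_in /=.
have [->|/inc_facet[_ ->]] := eqVneq (inc (cell j) t) 0; first by rewrite mulr0z mul0r.
by rewrite eqSS (negbTE dt) mulr0.
Qed.

End MixedComplex.

(** * Labels separate nested cells; the resolution *)

Local Open Scope classical_set_scope.

Lemma card_degree (m n : nat) (S : {set 'I_m * 'I_n}) :
  #|S| = (\sum_j degree S j)%N.
Proof.
rewrite -sum1_card big_mkcond sum_pair exchange_big; apply: eq_bigr => j _.
rewrite /degree -sum1_card [RHS]big_mkcond; apply: eq_bigr => i _.
by rewrite inE.
Qed.

(** Labels determine degrees, by testing divisibility of the label by the monomial
    whose exponents are the degrees of S; and the number of edges is the sum of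
    the degrees. *)
Lemma label_injective (R : realType) (m n : nat) (S T : {set 'I_m * 'I_n}) :
  forest R T -> S \subset T -> spanning S -> spanning T ->
  cell_label (@mcell R m n S) = cell_label (@mcell R m n T) -> S = T.
Proof.
move=> fT ST sS sT ST_label; apply/eqP; rewrite finset.eqEcard ST /= !card_degree.
apply: leq_sum => j _.
pose b := mpoly.Multinom [tuple degree S j | j < n].
have bE k : mpoly.fun_of_multinom b k = degree S k by rewrite mpoly.mnmE.
have := (divides_label b fT sT).1; rewrite -bE; apply.
by rewrite -ST_label; apply/(divides_label b (forest_sub ST fT) sS) => k; rewrite bE.
Qed.

Theorem corollary4p3 (R : realType) (K : fieldType) (n m : nat)
    (P : 'I_m -> set 'rV[R]_n) (X : set (set 'rV[R]_n))
    (hP : forall i : 'I_m, standard_simplex (P i))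
    (hX : fine_mixed_subdivision P X) :
  minimal_cellular_resolution K (@cell_label R n) X.
Proof.
have mixed := fine_cell hP hX.
have [[[finX polyX faceX meetX] coverX] _] := hX.
split=> [b|[s [t [Xs Xt [st ts] label_st]]]]; last first.
  have [T [sT fT tE]] := mixed t Xt.
  have sI : s `&` t = s by exact/setIidPl.
  have [S [sS _ sE]] := mixed s Xs.
  have s0 : s `&` t !=set0 by rewrite sI sE; exact: mcell_neq0.
  have [_] := meetX s t Xs Xt s0; rewrite sI tE => /(face_mcell sT)[S' [S'T sS' sE']].
  rewrite sE' tE in label_st; have := label_injective fT S'T sS' sT label_st.
  by move=> S'E; apply: ts; rewrite tE sE' S'E.
set Y := [set s | _]; have [->|Y0] := pselect (Y = set0); first by left.
right; have [cells XE] := (finite_seqP X).1 finX.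
have memX s : s \in cells <-> X s by rewrite XE.
pose ys := [seq s <- undup cells | divides (cell_label s) b].
have ysP s : s \in ys = (s \in cells) && divides (cell_label s) b.
  by rewrite mem_filter mem_undup andbC.
have -> : Y = [set` ys].
  apply/seteqP; split=> s; first by case=> /memX sc sb; rewrite /= ysP sc.
  by rewrite /= ysP => /andP[/memX].
have ys0 : exists s, s \in ys.
  have /set0P[s [/memX sc sb]] : Y != set0 by apply/eqP.
  by exists s; rewrite ysP sc.
have [f [l [flag_inj flag_vec]]] := transversal_flag cells.
have [a supporting] : exists a : set 'rV[R]_n -> set 'rV[R]_n -> 'rV[R]_n,
    forall s t, face t s -> t = maximizers (a s t) s.
  have /choice[a ha] : forall st : set 'rV[R]_n * set 'rV[R]_n, exists a : 'rV[R]_n,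
      face st.2 st.1 -> st.2 = maximizers a st.1.
    move=> [s t]; have [[a tE]|nst] := pselect (face t s); first by exists a.
    by exists 0.
  by exists (fun s t => a (s, t)) => s t; exact: (ha (s, t)).
apply: (below_acyclic (cells := cells) (P := minkowski_sum P) (b := b) (m := m)
  K _ _ _ _ _ _ _ ysP ys0 flag_inj flag_vec supporting).
- by move=> s /memX/mixed.
- by move=> s /memX/polyX.
- by move=> s F /memX Xs /(faceX _ _ Xs)/memX.
- by move=> s t /memX Xs /memX Xt; exact: meetX.
- apply: minkowski_sum_convex => i; have [S [_ ->]] := hP i.
  exact: conv_image_convex.
- move=> x; rewrite -coverX; split=> [[s /memX sc sx]|[s /memX Xs sx]]; by exists s.
- by rewrite filter_uniq // undup_uniq.
Qed.
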